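(* Let $w$ be the $A1_\epsilon$ universal weight system for framed knots, whose values on chord diagrams are polynomials in $c$ and $y$, and let $\bar w=w\circ\phi$ be the corresponding universal weight system for unframed knots, $\phi$ being the deframing operator. Then for any chord diagram $D$, $$\bar w(D)=w(D)\big|_{c=0},$$ where $w(D)|_{c=0}$ is obtained from the polynomial $w(D)\in\mathbb{K}[c,y]$ by setting $c=0$ (with $y$ regarded as an independent variable).
   Context: Let $\mathbb{K}$ be a field of characteristic zero and $\epsilon\in\{1,-1\}$. $A1_\epsilon$ is the four-dimensional $\mathbb{Z}_2\times\mathbb{Z}_2$-graded Lie algebra with basis $Q_0=H,Q_1,Q_2,Q_3$ of degrees $(0,0),(1,0),(0,1),(1,1)$ and relations $[H,Q_k]=0$, $\{Q_1,Q_2\}=Q_3$, $\{Q_2,Q_3\}=\epsilon Q_1$, $\{Q_3,Q_1\}=Q_2$. Its universal enveloping algebra $\mathcal{U}$ is the unital associative $\mathbb{K}$-algebra generated by $Q_0,Q_1,Q_2,Q_3$ with relations $Q_0Q_k=Q_kQ_0$ $(k=1,2,3)$, $Q_1Q_2+Q_2Q_1=Q_3$, $Q_2Q_3+Q_3Q_2=\epsilon Q_1$, $Q_3Q_1+Q_1Q_3=Q_2$. Put $b^{(0)}=1$, $b^{(1)}=\epsilon$, $b^{(2)}=b^{(3)}=1$, $c=Q_0^2+\epsilon Q_1^2+Q_2^2+Q_3^2$ (the central Casimir element) and $y=c-Q_0^2$. For $\mu,\nu\in\{0,1,2,3\}$ let $\sigma(\mu,\nu)=-1$ if $\mu,\nu$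 are distinct and both nonzero, and $\sigma(\mu,\nu)=1$ otherwise. The elements $c,y$ of the center are algebraically independent. A chord diagram of order $n$ is an oriented circle with $2n$ distinct points grouped into $n$ pairs (chords), up to orientation-preserving homeomorphism. Two chords intersect if their endpoints alternate along the circle. $\mathcal{A}_n$ is the space of formal $\mathbb{K}$-linear combinations of chord diagrams of order $n$ modulo the standard four-term (4T) relations. The $A1_\epsilon$ universal weight system $w$ (for framed knots) is defined on a chord diagram $D$ of order $n$ as follows: cut the circle at a point which is not an endpoint, and let $p_1,\dots,p_{2n}$ be the endpoints in the order of the orientation. Then $$w(D)=\sum_{\mu}\ \prod_{e}b^{(\mu(e))}\ \prod_{\{e,e'\}}\sigma(\mu(e),\mu(e'))\ \ Q_{\mu(p_1)}Q_{\mu(p_2)}\cdots Q_{\mu(p_{2n})}\in Z(\mathcal{U}),$$ where $\mu$ runs over all maps from the set of chords to $\{0,1,2,3\}$, $e$ runs over the chords, $\{e,e'\}$ runs over the unordered pairs of intersecting chords, and $\mu(p_k)$ is the label of the chord ending at $p_k$; $w$ of the diagram without chords is $1$. It is extended linearly, respects the 4T relations, and takes values in $\mathbb{K}[c,y]$. In an identity between several diagrams sharing the same circle, all of them are cut at the same point. Deframing: $s:\mathcal{A}_n\to\mathcal{A}_{n-1}$ is the linear map $s(D)=\sum_a (D-a)$, the sum over all chords $a$ of $D$, with $s(D)=0$ if $D$ has no chord. $\theta:\mathcal{A}_n\to\mathcal{A}_{n+1}$ is the linear map taking $D$ to its connected sum with the chord diagram having a single chord, i.e. inserting in $D$ an isolated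 chord with two consecutive endpoints (well defined modulo 4T). The deframing operator is $\phi=\sum_{k=0}^{n}\frac{(-1)^k}{k!}\theta^k s^k:\mathcal{A}_n\to\mathcal{A}_n$, and $\bar w(D)=w(\phi(D))$ for $D\in\mathcal{A}_n$. *)

(* Defs.v *)
From HB Require Import structures.
From mathcomp Require Import all_boot all_order all_fingroup all_algebra.
From mathcomp Require Import generic_quotient boolp monalg.

Set Implicit Arguments.
Unset Strict Implicit.
Unset Printing Implicit Defensive.

Import GRing.Theory.
Local Open Scope ring_scope.
Local Open Scope quotient_scope.

(** * Quotient of an algebra by a proper two-sided ideal

    [ring_quotient] only equips quotients of commutative rings with a product. *)

Section AlgebraQuotient.
Variables (K : fieldType) (A : algType K).

Definition two_sided_ideal (I : {pred A}) : Prop :=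
  [/\ 1 \notin I, forall a x, x \in I -> a * x \in I
    & forall a x, x \in I -> x * a \in I].

Variables (I : zmodClosed A) (idI : two_sided_ideal I).

Definition alg_quot of two_sided_ideal I := Quotient.quot I.
Local Notation Q := (alg_quot idI).

HB.instance Definition _ := EqQuotient.on Q.
HB.instance Definition _ := Choice.on Q.
HB.instance Definition _ := GRing.Zmodule.on Q.

Definition alg_quot_one : Q := lift_cst Q 1.
Definition alg_quot_mul := lift_op2 Q *%R.
Definition alg_quot_scale (k : K) := lift_op1 Q ( *:%R k).

Fact alg_quotE (x y : A) : (\pi_Q x == \pi_Q y) = (x - y \in I).
Proof. by rewrite Quotient.idealrBE. Qed.

Fact alg_quot_repr x : x - repr (\pi_Q x) \in I.
Proof. by rewrite -alg_quotE reprK. Qed.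

Fact alg_quot_piB : {morph \pi_Q : x y / x - y}.
Proof. by move=> x y; rewrite Quotient.pi_add Quotient.pi_opp. Qed.

Fact alg_quot_piD : {morph \pi_Q : x y / x + y}.
Proof. exact: Quotient.pi_add. Qed.

Fact alg_quot_pi0 : \pi_Q 0 = 0.
Proof. by rewrite -(subrr 0) alg_quot_piB subrr. Qed.

Fact alg_quot_piM : {morph \pi_Q : x y / x * y >-> alg_quot_mul x y}.
Proof.
move=> x y; rewrite /alg_quot_mul; unlock; apply/eqP; rewrite alg_quotE.
have [_ IMl IMr] := idI; set x' := repr _; set y' := repr _.
rewrite -(subrK (x * y') (x * y)) -mulrBr -addrA -mulrBl.
by apply: rpredD; [apply: IMl|apply: IMr]; exact: alg_quot_repr.
Qed.

Fact alg_quot_piZ k : {morph \pi_Q : x / k *: x >-> alg_quot_scale k x}.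
Proof.
move=> x; rewrite /alg_quot_scale; unlock; apply/eqP; rewrite alg_quotE.
have [_ IMl _] := idI; rewrite -scalerBr -[_ - _]mul1r scalerAl.
by apply: IMl; exact: alg_quot_repr.
Qed.

Fact alg_quot_mulA : associative alg_quot_mul.
Proof.
move=> u v w; rewrite -[u]reprK -[v]reprK -[w]reprK.
by rewrite -!alg_quot_piM mulrA.
Qed.

Fact alg_quot_mul1 : left_id alg_quot_one alg_quot_mul.
Proof.
move=> u; rewrite -[u]reprK /alg_quot_one; unlock.
by rewrite -alg_quot_piM mul1r.
Qed.

Fact alg_quot_mulr1 : right_id alg_quot_one alg_quot_mul.
Proof.
move=> u; rewrite -[u]reprK /alg_quot_one; unlock.
by rewrite -alg_quot_piM mulr1.
Qed.

Fact alg_quot_mulDl : left_distributive alg_quot_mul +%R.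
Proof.
move=> u v w; rewrite -[u]reprK -[v]reprK -[w]reprK.
by rewrite -!alg_quot_piM -!alg_quot_piD -alg_quot_piM mulrDl.
Qed.

Fact alg_quot_mulDr : right_distributive alg_quot_mul +%R.
Proof.
move=> u v w; rewrite -[u]reprK -[v]reprK -[w]reprK.
by rewrite -!alg_quot_piM -!alg_quot_piD -alg_quot_piM mulrDr.
Qed.

Fact alg_quot_one_neq0 : alg_quot_one != 0.
Proof.
rewrite -alg_quot_pi0 /alg_quot_one; unlock.
by have [I1 _ _] := idI; rewrite alg_quotE subr0.
Qed.

HB.instance Definition _ := GRing.Zmodule_isNzRing.Build Q
  alg_quot_mulA alg_quot_mul1 alg_quot_mulr1 alg_quot_mulDl alg_quot_mulDr
  alg_quot_one_neq0.

Fact alg_quot_scaleA a b v :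
  alg_quot_scale a (alg_quot_scale b v) = alg_quot_scale (a * b) v.
Proof. by rewrite -[v]reprK -!alg_quot_piZ scalerA. Qed.

Fact alg_quot_scale1 : left_id 1 alg_quot_scale.
Proof. by move=> v; rewrite -[v]reprK -alg_quot_piZ scale1r. Qed.

Fact alg_quot_scaleDr : right_distributive alg_quot_scale +%R.
Proof.
move=> a u v; rewrite -[u]reprK -[v]reprK.
by rewrite -!alg_quot_piZ -!alg_quot_piD -alg_quot_piZ scalerDr.
Qed.

Fact alg_quot_scaleDl v : {morph alg_quot_scale^~ v : a b / a + b}.
Proof.
move=> a b; rewrite -[v]reprK.
by rewrite -!alg_quot_piZ -alg_quot_piD scalerDl.
Qed.

HB.instance Definition _ := GRing.Zmodule_isLmodule.Build K Q
  alg_quot_scaleA alg_quot_scale1 alg_quot_scaleDr alg_quot_scaleDl.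

Fact alg_quot_scaleAl (a : K) (u v : Q) : a *: (u * v) = (a *: u) * v.
Proof.
rewrite -[u]reprK -[v]reprK; change
  (alg_quot_scale a (alg_quot_mul (\pi_Q (repr u)) (\pi_Q (repr v))) =
   alg_quot_mul (alg_quot_scale a (\pi_Q (repr u))) (\pi_Q (repr v))).
by rewrite -alg_quot_piM -!alg_quot_piZ -alg_quot_piM scalerAl.
Qed.

HB.instance Definition _ := GRing.Lmodule_isLalgebra.Build K Q alg_quot_scaleAl.

Fact alg_quot_scaleAr (a : K) (u v : Q) : a *: (u * v) = u * (a *: v).
Proof.
rewrite -[u]reprK -[v]reprK; change
  (alg_quot_scale a (alg_quot_mul (\pi_Q (repr u)) (\pi_Q (repr v))) =
   alg_quot_mul (\pi_Q (repr u)) (alg_quot_scale a (\pi_Q (repr v)))).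
by rewrite -alg_quot_piM -!alg_quot_piZ -alg_quot_piM scalerAr.
Qed.

HB.instance Definition _ := GRing.Lalgebra_isAlgebra.Build K Q alg_quot_scaleAr.

End AlgebraQuotient.

(** * Two-sided ideal generated by the relations [l = r], [R l r] *)

Section GeneratedIdeal.
Variables (K : fieldType) (A : algType K) (R : A -> A -> Prop).

Inductive gen_ideal : A -> Prop :=
| gen_ideal_rel l r : R l r -> gen_ideal (l - r)
| gen_ideal_0 : gen_ideal 0
| gen_ideal_B x y : gen_ideal x -> gen_ideal y -> gen_ideal (x - y)
| gen_ideal_Ml a x : gen_ideal x -> gen_ideal (a * x)
| gen_ideal_Mr a x : gen_ideal x -> gen_ideal (x * a).

Definition gen_ideal_pred : {pred A} := fun x => `[< gen_ideal x >].

Fact gen_idealP x : reflect (gen_ideal x) (x \in gen_ideal_pred).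
Proof. exact: asboolP. Qed.

Fact gen_ideal_zmod_closed : zmod_closed gen_ideal_pred.
Proof.
split; first by apply/gen_idealP; exact: gen_ideal_0.
by move=> x y /gen_idealP ? /gen_idealP ?; apply/gen_idealP; exact: gen_ideal_B.
Qed.
HB.instance Definition _ :=
  GRing.isZmodClosed.Build A gen_ideal_pred gen_ideal_zmod_closed.

Fact gen_ideal_two_sided (f : {rmorphism A -> K}) :
  (forall l r, R l r -> f l = f r) -> two_sided_ideal gen_ideal_pred.
Proof.
move=> fR; split.
- suff f0 x : gen_ideal x -> f x = 0.
    by apply/gen_idealP => /f0/eqP; rewrite rmorph1 oner_eq0.
  elim=> {x} [l r /fR flr| |x y _ fx _ fy|a x _ fx|a x _ fx].
  + by rewrite rmorphB flr subrr.
  + exact: rmorph0.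
  + by rewrite rmorphB fx fy subrr.
  + by rewrite rmorphM fx mulr0.
  + by rewrite rmorphM fx mul0r.
- by move=> a x /gen_idealP ?; apply/gen_idealP; exact: gen_ideal_Ml.
- by move=> a x /gen_idealP ?; apply/gen_idealP; exact: gen_ideal_Mr.
Qed.

End GeneratedIdeal.

(** * The enveloping algebra of the graded Lie algebra A1_eps *)

(* An alias, as monalg only declares {malg K[M]} an algType for commutative M. *)
Definition free_alg (K : fieldType) (I : choiceType) : Type :=
  {malg K[{fmonom I}]}.

Section FreeAlgebra.
Variables (K : fieldType) (I : choiceType).
Local Notation F := (free_alg K I).

HB.instance Definition _ := GRing.Lalgebra.on F.

Fact free_alg_scalerAr (k : K) (x y : F) : k *: (x * y) = x * (k *: y).
Proof.
have kC : k%:MP * x = x * k%:MP :> {malg K[{fmonom I}]}.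
  rewrite !malgM_def /malgC fgmulUg fgmulgU.
  by apply: eq_bigr => m _; rewrite mulm1 mul1m mulrC.
transitivity (k%:MP * (x * y) : F); first by rewrite [RHS]mul_malgC.
transitivity (x * (k%:MP * y) : F); last by congr (x * _); exact: mul_malgC.
exact: etrans (mulrA _ _ _) (etrans (congr1 (fun z : F => z * y) kC) (esym (mulrA _ _ _))).
Qed.

HB.instance Definition _ := GRing.Lalgebra_isAlgebra.Build K F free_alg_scalerAr.

Definition free_gen (i : I) : F := << fmu i >>.

Definition augmentation : F -> K := @mcoeff {fmonom I} K mone.
HB.instance Definition _ :=
  GRing.RMorphism.copy augmentation (@mcoeff {fmonom I} K mone).

Fact augmentation_gen i : augmentation (free_gen i) = 0.
Proof. by rewrite /augmentation mcoeffU1 /fmu -val_eqE /= fm1 fmE. Qed.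

End FreeAlgebra.

Section Enveloping.
Variables (K : fieldType) (eps : K).

Local Notation F := (free_alg K 'I_4).
Local Notation X k := (free_gen K (@Ordinal 4 k isT)).

Inductive A1_rel : F -> F -> Prop :=
| A1_rel_H k : A1_rel (X 0 * free_gen K k) (free_gen K k * X 0)
| A1_rel_12 : A1_rel (X 1 * X 2 + X 2 * X 1) (X 3)
| A1_rel_23 : A1_rel (X 2 * X 3 + X 3 * X 2) (eps *: X 1)
| A1_rel_31 : A1_rel (X 3 * X 1 + X 1 * X 3) (X 2).

Local Notation f := (@augmentation K 'I_4).

Fact A1_two_sided : two_sided_ideal (gen_ideal_pred A1_rel).
Proof.
have XX0 i j : f (free_gen K i * free_gen K j) = 0.
  by rewrite rmorphM /= augmentation_gen mul0r.
have XD0 i j k l :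
    f (free_gen K i * free_gen K j + free_gen K k * free_gen K l) = 0.
  by rewrite rmorphD; exact: etrans (congr2 +%R (XX0 _ _) (XX0 _ _)) (addr0 0).
have XZ0 k i : f (k *: free_gen K i) = 0.
  by rewrite -mulr_algl rmorphM /= augmentation_gen mulr0.
apply: (gen_ideal_two_sided (f := f)) => _ _ [k|||].
- exact: etrans (XX0 _ _) (esym (XX0 _ _)).
- exact: etrans (XD0 _ _ _ _) (esym (augmentation_gen _ _)).
- exact: etrans (XD0 _ _ _ _) (esym (XZ0 _ _)).
- exact: etrans (XD0 _ _ _ _) (esym (augmentation_gen _ _)).
Qed.

Definition A1env : algType K := alg_quot A1_two_sided.

Definition Q (i : 'I_4) : A1env := \pi_(alg_quot A1_two_sided) (free_gen K i).

Definition bcoef (i : 'I_4) : K := if val i == 1%N then eps else 1.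

Definition casimir : A1env := \sum_(i < 4) bcoef i *: Q i ^+ 2.

Definition y_elt : A1env := casimir - Q ord0 ^+ 2.

End Enveloping.

Definition sigma (K : fieldType) (i j : 'I_4) : K :=
  if [&& i != j, i != ord0 & j != ord0] then -1 else 1.

(* K[c, y] is represented as (K[y])[c]: [p`_i] is the polynomial in y which is
   the coefficient of c^i, and setting c = 0 is [p.[0]]. *)
Definition eval_cy (K : fieldType) (eps : K) (p : {poly {poly K}}) :
    A1env eps :=
  (map_poly (horner_alg (y_elt eps)) p).[casimir eps].

(** * Chord diagrams

    A chord diagram of order n whose circle has been cut and whose chords are
    numbered by 'I_n is the word listing the chord ending at each endpoint. *)

Record diag (n : nat) := Diag {
  word :> (n.*2).-tuple 'I_n;
  _ : [forall e, count_mem e word == 2%N] }.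

HB.instance Definition _ n := [isSub for @word n].
HB.instance Definition _ n := [Finite of diag n by <:].

Fact word_size n (s : seq 'I_n) :
  [forall e, count_mem e s == 2%N] -> size s == n.*2.
Proof.
move=> /forallP s2; have -> : size s = (\sum_(e < n) count_mem e s)%N.
  elim: s {s2} => [|x s IHs] /=; first by rewrite big1.
  rewrite big_split /= -IHs (bigD1 x) //= eqxx big1 ?addn0 // => e.
  by rewrite eq_sym => /negPf->.
rewrite (eq_bigr (fun=> 2%N)) => [|e _]; last exact/eqP.
by rewrite sum_nat_const card_ord muln2.
Qed.

Definition diag_of_word n (s : seq 'I_n) (s2 : [forall e, count_mem e s == 2%N]) :
  diag n := @Diag n (Tuple (word_size s2)) s2.

Definition intersect n (D : diag n) (e f : 'I_n) : bool :=
  let s := [seq x <- D | (x == e) || (x == f)] in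
  (s == [:: e; f; e; f]) || (s == [:: f; e; f; e]).

Fact del_word n (D : diag n.+1) (a : 'I_n.+1) :
  [forall e, count_mem e (pmap (unlift a) D) == 2%N].
Proof.
apply/forallP => e; case: D => s /= /forallP/(_ (lift a e))/eqP s2.
apply/eqP; rewrite -[RHS]s2; elim: (tval s) => //= x t <-; case: unliftP => [j|] -> /=.
  by rewrite (inj_eq lift_inj).
by rewrite (negPf (neq_lift a e)).
Qed.

Definition del_chord n (D : diag n.+1) (a : 'I_n.+1) : diag n :=
  diag_of_word (del_word D a).

Fact isolated_word n (D : diag n) :
  [forall e, count_mem e [:: ord0, ord0 & map (lift ord0) D] == 2%N].
Proof.
apply/forallP => e; rewrite /= count_map; case: (unliftP ord0 e) => [f|] ->.
  rewrite (negPf (neq_lift _ _)) !add0n; case: D => s /= /forallP/(_ f)/eqP s2.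
  by apply/eqP; rewrite -[RHS]s2; apply: eq_count => x /=; rewrite (inj_eq lift_inj).
by rewrite eqxx (eq_count (a2 := pred0)) ?count_pred0.
Qed.

(* The isolated chord is inserted at the cut; modulo 4T the place is irrelevant. *)
Definition add_isolated n (D : diag n) : diag n.+1 :=
  diag_of_word (isolated_word D).

(** * Formal linear combinations of chord diagrams and the space A_n *)

Section ChordSpace.
Variable K : fieldType.

Definition chords (n : nat) : lmodType K := {ffun diag n -> K^o}.

Definition delta n (D : diag n) : chords n := [ffun E => (E == D)%:R].

Definition extend n (V : lmodType K) (F : diag n -> V) (x : chords n) : V :=
  \sum_D (x : {ffun _ -> _}) D *: F D.

(* The subspace spanned by the differences of two words which represent the same
   chord diagram (renumbering of the chords, change of the cut) and by the 4T
   elements; A_n is the quotient of [chords n] by it. In a 4T element, one endpoint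
   of the chord a is put immediately before or after each of the endpoints of b. *)
Inductive relator n : chords n -> Prop :=
| relator_renumber (D D' : diag n) (p : {perm 'I_n}) :
    D' = map p D :> seq _ -> relator (delta D - delta D')
| relator_cut (D D' : diag n) k :
    D' = rot k D :> seq _ -> relator (delta D - delta D')
| relator_4T (D1 D2 D3 D4 : diag n) (a b : 'I_n) (p q r : seq 'I_n) :
    D1 = p ++ [:: a; b] ++ q ++ [:: b] ++ r :> seq _ ->
    D2 = p ++ [:: b; a] ++ q ++ [:: b] ++ r :> seq _ ->
    D3 = p ++ [:: b] ++ q ++ [:: a; b] ++ r :> seq _ ->
    D4 = p ++ [:: b] ++ q ++ [:: b; a] ++ r :> seq _ ->
    relator (delta D1 - delta D2 + delta D3 - delta D4)
| relator_0 : relator 0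
| relator_lin (k : K) x y : relator x -> relator y -> relator (k *: x + y).

Definition eq_A n (x y : chords n) : Prop := relator (x - y).

Definition s_map n : chords n.+1 -> chords n :=
  extend (fun D => \sum_(a < n.+1) delta (del_chord D a)).

Definition theta n : chords n -> chords n.+1 :=
  extend (fun D => delta (add_isolated D)).

(* theta^k s^k, where s = 0 on diagrams without chords *)
Fixpoint theta_s (k n : nat) : chords n -> chords n :=
  match k, n with
  | 0, _ => fun x => x
  | k'.+1, n'.+1 => fun x => theta (theta_s k' (s_map x))
  | _.+1, 0 => fun _ => 0
  end.

Definition phi n (x : chords n) : chords n :=
  \sum_(k < n.+1) ((-1) ^+ k / k`!%:R) *: theta_s k x.

End ChordSpace.

(** * The A1_eps universal weight system *)

Section WeightSystem.
Variables (K : fieldType) (eps : K).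

Definition weight n (D : diag n) : A1env eps :=
  \sum_(mu : {ffun 'I_n -> 'I_4})
    ((\prod_(e < n) bcoef eps (mu e))
     * \prod_(e < n) \prod_(f < n | (e < f)%N && intersect D e f)
         sigma K (mu e) (mu f))
    *: \prod_(x <- D) Q eps (mu x).

Definition weight_lin n : chords K n -> A1env eps := extend (@weight n).

End WeightSystem.

(* Main.v *)
From HB Require Import structures.
Require Import Defs.
From mathcomp Require Import all_boot all_order all_fingroup all_algebra.
From mathcomp Require Import finmap generic_quotient boolp monalg zify ring.

Set Implicit Arguments.
Unset Strict Implicit.
Unset Printing Implicit Defensive.
Import GRing.Theory.
Local Open Scope ring_scope.

(** The proof rests on three facts.

    Untwisting. Tensoring Q_1, Q_2, Q_3 with three pairwise anticommuting 2 x 2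
    matrices of signs turns the anticommutators into commutators: the elements J_k so
    obtained span a three-dimensional Lie algebra, a form of sl_2. In the product
    of the J_k along a chord diagram the matrices contribute one sign for every pair of
    intersecting chords with distinct nonzero labels, which is the sign of the graded
    weight system, and one sign for every chord labelled 3, which is absorbed in the
    invariant form ([word_sum_weight]). So w(D) is an ordinary Lie algebra weight. As
    the invariant form is preserved by the brackets ([casimir_inv]), this weight is
    independent of the cut and respects the 4T relations ([word_sum_rot],
    [word_sum_4T]), and hence w is well defined modulo the relators.

    Dependence on c. The generator Q_0 is central and its label has trivial signs. So
    w(D) is the value at X = Q_0^2 of a polynomial W_D ([word_poly]), in which the
    coefficient of X^k is the sum of the weights with labels 1, 2, 3 of the diagrams
    obtained by deleting k chords. Those weights are polynomials in the Casimir element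
    of the Lie algebra, which is y: products of two Levi-Civita symbols being
    combinations of Kronecker symbols, one only meets diagrams with at most one
    trivalent vertex, and an induction on the number of endpoints applies
    ([closed_tripod_sum_in]). As Q_0^2 = c - y, this proves w(D) in K[c, y].

    Deframing. Deleting a chord in all possible ways differentiates W_D
    ([deriv_word_poly]), and adding an isolated chord multiplies the weight by c. So
    w(phi(D)) is the sum of the (-c)^k / k! W_D^(k)(c - y), that is W_D(- y) by the Taylor
    formula ([weight_lin_phi]). This is the value at c = 0 of W_D(c - y), which is the
    polynomial representing w(D). The latter is unique because c and y are
    algebraically independent ([eval_cy_inj]): they act on the lowest weight vectors
    of a two-parameter family of Verma modules by the scalars h^2 + eps l (l + 1) and
    eps l (l + 1). *)

Local Notation o0 := (@Ordinal 4 0 isT).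
Local Notation o1 := (@Ordinal 4 1 isT).
Local Notation o2 := (@Ordinal 4 2 isT).
Local Notation o3 := (@Ordinal 4 3 isT).

(* Linear arithmetic on the goal, numbers of occurrences and equality tests being
   treated as unknown naturals. *)
Ltac count_lia :=
  repeat match goal with |- context [@count ?A ?p ?s] =>
    let k := fresh "k" in set k := @count A p s; move: k => k end;
  repeat match goal with |- context [nat_of_bool (@eq_op ?A ?p ?q)] =>
    let k := fresh "k" in set k := nat_of_bool (@eq_op A p q); move: k => k end;
  clear; lia.

Lemma ord4_ind (P : 'I_4 -> Prop) : P o0 -> P o1 -> P o2 -> P o3 -> forall i, P i.
Proof.
move=> P0 P1 P2 P3 [[|[|[|[|k]]]] lk] //;
  by rewrite (bool_irrelevance lk isT).
Qed.

Lemma sum_ord4 (V : nmodType) (F : 'I_4 -> V) :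
  \sum_i F i = F o0 + F o1 + F o2 + F o3.
Proof.
rewrite !big_ord_recr big_ord0 /= add0r.
by do !congr (_ + _); congr F; apply: val_inj.
Qed.

Lemma ord4_0E : o0 = ord0.
Proof. exact: val_inj. Qed.

(** The Levi-Civita symbol on the labels 1, 2, 3; it vanishes if a label is 0. *)
Definition levi (i j k : 'I_4) : int :=
  match val i, val j, val k with
  | 1%N, 2%N, 3%N | 2%N, 3%N, 1%N | 3%N, 1%N, 2%N => 1
  | 2%N, 1%N, 3%N | 1%N, 3%N, 2%N | 3%N, 2%N, 1%N => -1
  | _, _, _ => 0
  end.

Lemma leviC i j k : levi j i k = - levi i j k.
Proof. by elim/ord4_ind: i; elim/ord4_ind: j; elim/ord4_ind: k. Qed.

Lemma leviCr i j k : levi i k j = - levi i j k.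
Proof. by elim/ord4_ind: i; elim/ord4_ind: j; elim/ord4_ind: k. Qed.

Lemma levi_cyc i j k : levi j k i = levi i j k.
Proof. by elim/ord4_ind: i; elim/ord4_ind: j; elim/ord4_ind: k. Qed.

Lemma levi0 i j : levi i j ord0 = 0.
Proof. by elim/ord4_ind: i; elim/ord4_ind: j. Qed.

Lemma levi0m i j : levi i ord0 j = 0.
Proof. by elim/ord4_ind: i; elim/ord4_ind: j. Qed.

Lemma levi0l i j : levi ord0 i j = 0.
Proof. by elim/ord4_ind: i; elim/ord4_ind: j. Qed.

(** The invariant form, in the diagonal basis, of the Lie algebra with brackets
    [J_i, J_j] = sum_k levi i j k metric_k J_k. The value at 3 is -1, and not
    b^(3) = 1, because the twisted generator J_3 squares to - Q_3^2. *)
Definition metric (e : int) (i : 'I_4) : int := nth 0 [:: 1; e; 1; -1] i.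

(** Contracting one leg of each of two trivalent vertices; 1 * e * 1 * -1 = -e is
    the determinant of the form. *)
Lemma levi_contract (e : int) (i j a c : 'I_4) : e = 1 \/ e = -1 ->
    a != ord0 -> c != ord0 ->
  \sum_k metric e i * metric e k * metric e j * levi a k c * levi i k j
  = - e * (((i == a) && (j == c))%:R - ((i == c) && (j == a))%:R).
Proof.
move=> e1; rewrite sum_ord4; elim/ord4_ind: a => //; elim/ord4_ind: c => // _ _;
  elim/ord4_ind: i; elim/ord4_ind: j; by case: e1 => ->.
Qed.

Lemma sum_neq0 (V : nmodType) (F : 'I_4 -> V) :
  F ord0 = 0 -> \sum_(k | k != ord0) F k = \sum_k F k.
Proof. by move=> F0; rewrite [RHS](bigD1 ord0) //= F0 add0r. Qed.

(** * Labellings of finitely many names *)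

Section Labellings.
Variable T : finType.
Implicit Types (mu : {ffun T -> 'I_4}) (a : T) (k : 'I_4) (A : {set T}).

(** The names with a nonzero label. *)
Definition support mu : {set T} := [set x | mu x != ord0].

Definition update mu a k : {ffun T -> 'I_4} := [ffun x => if x == a then k else mu x].

Lemma updateE mu a k x : update mu a k x = if x == a then k else mu x.
Proof. by rewrite ffunE. Qed.

Lemma support0 mu A a : support mu == A -> a \notin A -> mu a = ord0.
Proof. by move=> /eqP<-; rewrite inE negbK => /eqP. Qed.

Lemma support_neq0 mu A a : support mu == A -> a \in A -> mu a != ord0.
Proof. by move=> /eqP<-; rewrite inE. Qed.

(** Summing apart over the label of [a], which is nonzero as [a] is in the support. *)
Lemma big_support (V : nmodType) A a (F : {ffun T -> 'I_4} -> V) : a \in A ->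
  \sum_(mu | support mu == A) F mu
  = \sum_(mu | support mu == A :\ a) \sum_(k | k != ord0) F (update mu a k).
Proof.
move=> aA; pose h mu := update mu a ord0.
rewrite (partition_big h [pred mu | support mu == A :\ a]) /=; last first.
  move=> mu /eqP<-; apply/eqP/setP => x; rewrite !inE updateE.
  by case: (x == a).
apply: eq_bigr => mu muA; rewrite (reindex_onto (update mu a) (fun nu => nu a)) /=.
  apply: eq_bigl => k; rewrite updateE eqxx eqxx andbT; apply/andP/idP.
    by move=> [/support_neq0/(_ aA)]; rewrite updateE eqxx.
  move=> k0; split.
    move/eqP/setP: muA => muA; apply/eqP/setP => x; rewrite !inE updateE.
    by case: (x =P a) => [->|/eqP xa]; rewrite ?aA ?k0 //; have := muA x; rewrite !inE xa.
  apply/eqP/ffunP => x; rewrite !updateE; case: eqP => [->|//].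
  by rewrite (support0 muA) // !inE eqxx.
move=> nu /andP[_ /eqP<-]; apply/ffunP => x; rewrite !updateE.
by case: eqP => [->|].
Qed.

Lemma big_support0 (V : nmodType) (F : {ffun T -> 'I_4} -> V) :
  \sum_(mu | support mu == set0) F mu = F [ffun=> ord0].
Proof.
apply: big_pred1 => mu; apply/eqP/eqP => [/setP mu0|->].
  by apply/ffunP => x; rewrite ffunE; have := mu0 x; rewrite !inE => /negbFE/eqP.
by apply/setP => x; rewrite !inE ffunE.
Qed.

Lemma prod_update (B : 'I_4 -> int) mu a k : B ord0 = 1 -> mu a = ord0 ->
  \prod_x B (update mu a k x) = (\prod_x B (mu x)) * B k.
Proof.
move=> B0 mua; rewrite (bigD1 a) //= updateE eqxx mulrC.
rewrite [in RHS](bigD1 a) //= mua B0 mul1r; congr (_ * _).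
by apply: eq_bigr => x /negPf xa; rewrite updateE xa.
Qed.

Lemma prod_word_update (R : nzRingType) (J : 'I_4 -> R) mu a k (s : seq T) :
  a \notin s -> \prod_(x <- s) J (update mu a k x) = \prod_(x <- s) J (mu x).
Proof.
move=> aNs; apply: eq_big_seq => x xs; rewrite updateE; case: eqP => // xa.
by rewrite -xa xs in aNs.
Qed.

End Labellings.

Lemma count_sum (T : finType) (P : pred T) (s : seq T) :
  count P s = (\sum_(u | P u) count_mem u s)%N.
Proof.
elim: s => [|x s IH] /=; first by rewrite big1.
rewrite big_split /= IH; congr (_ + _)%N.
case: (boolP (P x)) => Px.
  rewrite (bigD1 x) //= eqxx big1 ?addn0 // => u /andP[_ ux].
  by rewrite eq_sym (negPf ux).
rewrite big1 // => u Pu; case: eqP => // xu.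
by rewrite xu Pu in Px.
Qed.

Lemma size_sum_count (T : finType) (s : seq T) :
  size s = (\sum_u count_mem u s)%N.
Proof. by rewrite -count_predT count_sum. Qed.

(** The word in which the name [d] is replaced by [a]. *)
Definition rename (T : eqType) (d a : T) (s : seq T) :=
  [seq if x == d then a else x | x <- s].

Lemma mem_rename (T : eqType) (d a : T) s z : a != d ->
  (z \in rename d a s) = (z == a) && (d \in s) || (z != d) && (z \in s).
Proof.
move=> ad; elim: s => [|x s IH] /=; first by rewrite !andbF.
rewrite !inE IH; have [->|xd] := eqVneq x d.
  by rewrite ?eqxx; case: (z == a); case: (z == d); case: (d \in s).
have [->|zx] //= := eqVneq z x.
by rewrite xd /= orbT.
Qed.

Lemma count_rename (T : eqType) (d a : T) s z : a != d ->
  count_mem z (rename d a s)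
  = (if z == d then 0 else count_mem z s + (z == a) * count_mem d s)%N.
Proof.
move=> ad; elim: s => [|x s IH] /=; first by case: eqP; rewrite ?muln0.
rewrite IH; have [->|xd] := eqVneq x d.
  rewrite ?(eq_sym d); have [->|zd] := eqVneq z d; rewrite ?(negPf ad) //.
  by rewrite 1?(eq_sym a); case: (z == a) => /=; lia.
have [->|zd] := eqVneq z d; first by rewrite (negPf xd).
by lia.
Qed.

Lemma prod_word_rename (T : finType) (R : nzRingType) (J : 'I_4 -> R)
    (mu : {ffun T -> 'I_4}) a d (s : seq T) :
  \prod_(x <- s) J (update mu d (mu a) x) = \prod_(x <- rename d a s) J (mu x).
Proof.
by rewrite big_map; apply: eq_bigr => x _; rewrite updateE; case: eqP.
Qed.

(** * Lie algebra weights of words *)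

Section Words.
(** [J 1], [J 2], [J 3] satisfy the relations of a three-dimensional simple Lie
    algebra, and [J 0] is central, in an arbitrary associative ring. *)
Variables (R : nzRingType) (e : int).
Hypothesis e1 : e = 1 \/ e = -1.
Variable J : 'I_4 -> R.
Hypothesis JC : forall i j,
  J i * J j - J j * J i = \sum_k J k *~ (levi i j k * metric e k).

Local Notation b := (metric e).

(** Invariance of the form: both ends of a chord are moved by the bracket with
    [J l], and the two contributions cancel. *)
Lemma casimir_inv l X :
  \sum_k ((J l * J k - J k * J l) * X * J k
          + J k * X * (J l * J k - J k * J l)) *~ b k = 0.
Proof.
under eq_bigr => k _ do rewrite JC mulr_suml mulr_suml mulr_sumr -big_split mulrz_suml.
rewrite /=.
under eq_bigr => k _ do under eq_bigr => m _ do
  rewrite mulrzDl !mulrzAl !mulrzAr -!mulrzA.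
under eq_bigr => k _ do rewrite big_split.
rewrite big_split /= [X in _ + X]exchange_big /= -big_split big1 // => k _.
rewrite -big_split big1 //= => m _.
rewrite -mulrzDr leviCr; set k1 := (X in _ *~ X).
by rewrite (_ : k1 = 0) // /k1; ring.
Qed.

(** Two adjacent legs of a vertex amount to a single letter. *)
Lemma levi_adjacent c : c != ord0 ->
  \sum_i \sum_j (J i * J j) *~ (b i * b j * levi i j c) = J c *~ - e.
Proof.
have red i j k : \sum_m J m *~ (levi i j m * b m) = J k *~ b k ->
    (J i * J j) *~ (b i * b j) - (J j * J i) *~ (b j * b i)
    = J k *~ (b i * b j * b k).
  move=> Jk; rewrite (mulrC (b j)) -mulrzBl JC Jk -mulrzA; congr (_ *~ _); ring.
have bE : b o1 * b o2 * b o3 = - e by rewrite /metric /=; ring.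
move: (metric e) red bE => B red BE; rewrite -BE.
have uni (i j k : 'I_4) : levi i j k = 1 -> (forall m, m != k -> levi i j m = 0) ->
    \sum_m J m *~ (levi i j m * B m) = J k *~ B k.
  move=> ijk ijm; rewrite (bigD1 k) //= ijk mul1r big1 ?addr0 // => m /ijm ->.
  by rewrite mul0r mulr0z.
rewrite !sum_ord4; elim/ord4_ind: c => // _;
  rewrite /levi /= !mulr0 !mulr0z ?(addr0, add0r) !mulr1 !mulrN1 !mulrNz.
- rewrite (red o2 o3 o1) //; last by apply: uni => //; elim/ord4_ind.
  by congr (_ *~ _); ring.
- rewrite addrC (red o3 o1 o2) //; last by apply: uni => //; elim/ord4_ind.
  by congr (_ *~ _); ring.
- rewrite (red o1 o2 o3) //; last by apply: uni => //; elim/ord4_ind.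
Qed.

(** The correction when a leg of the vertex (a, j, c) passes an end of the chord
    labelled [i]: the chord and the vertex merge into two chords. [X] and [Z] stand
    for the parts of the word containing the other end of that chord. *)
Lemma levi_exchange a c (X Z : 'I_4 -> R) : a != ord0 -> c != ord0 ->
  \sum_i \sum_j (X i * (J i * J j - J j * J i) * Z i) *~ (b i * b j * levi a j c)
  = (X a * J c * Z a - X c * J a * Z c) *~ - e.
Proof.
move=> a0 c0.
transitivity (\sum_i \sum_m \sum_j (X i * J m * Z i) *~
                (b i * b j * b m * levi a j c * levi i j m)).
  apply: eq_bigr => i _; rewrite exchange_big /=; apply: eq_bigr => j _.
  rewrite JC mulr_sumr mulr_suml mulrz_suml; apply: eq_bigr => m _.
  rewrite !(mulrzAl, mulrzAr) -mulrzA; congr (_ *~ _); ring.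
under eq_bigr => i _ do under eq_bigr => m _ do
  rewrite -mulrz_sumr levi_contract //.
transitivity (\sum_i \sum_m
   ((if (i == a) && (m == c) then (X i * J m * Z i) *~ - e else 0)
    - (if (i == c) && (m == a) then (X i * J m * Z i) *~ - e else 0))).
  apply: eq_bigr => i _; apply: eq_bigr => m _.
  rewrite mulrBr mulrzBr; case: (_ && _); case: (_ && _);
    by rewrite ?mulr1 ?mulr0 ?mulr0z.
under eq_bigr => i _ do rewrite sumrB.
rewrite sumrB !pair_big /= -!big_mkcond /= mulrzBl.
congr (_ - _).
  by rewrite (eq_bigl (xpred1 (a, c))) ?big_pred1_eq.
by rewrite (eq_bigl (xpred1 (c, a))) ?big_pred1_eq.
Qed.

Variable T : finType.
Implicit Types (mu : {ffun T -> 'I_4}) (a c d : T) (s : seq T).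

Local Notation wv mu s := (\prod_(x <- s) J (mu x)).
Local Notation bw mu := (\prod_x b (mu x)).

(** The weight of a word in which every name occurring stands for a chord: the
    names of the word get labels 1, 2, 3 and the other names get label 0, so that
    unused names do not count. *)
Definition closed_sum s : R :=
  \sum_(mu | support mu == [set x in s]) wv mu s *~ bw mu.

(** The weight of a word in which [a], [d], [c] are the legs of one trivalent
    vertex, and the other names stand for chords. *)
Definition tripod_sum a d c s : R :=
  \sum_(mu | support mu == [set x in s])
    wv mu s *~ (bw mu * levi (mu a) (mu d) (mu c)).

Lemma tripodC a d c s : tripod_sum d a c s = - tripod_sum a d c s.
Proof.
rewrite /tripod_sum -sumrN; apply: eq_bigr => mu _.
by rewrite leviC mulrN mulrNz.
Qed.

Lemma tripod_cyc a d c s : tripod_sum d c a s = tripod_sum a d c s.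
Proof. by apply: eq_bigr => mu _; rewrite levi_cyc. Qed.

(** Exchanging adjacent ends of two chords [d] and [a]: the commutator joins the
    chords into a vertex whose third leg gets a new name [c]. *)
Lemma closed_sum_swap x y a d c : c \notin x ++ y -> d != a ->
  d \in x ++ y -> a \in x ++ y ->
  closed_sum (x ++ [:: d, a & y]) - closed_sum (x ++ [:: a, d & y])
  = tripod_sum d a c (x ++ c :: y).
Proof.
move=> cxy da dxy axy; pose A := [set z in x ++ y].
have A1 : [set z in x ++ [:: d, a & y]] = A.
  apply/setP => z; rewrite !(inE, mem_cat); rewrite !mem_cat in dxy axy.
  have [->|_] := eqVneq z d; first by rewrite orbT dxy.
  by have [->|_] := eqVneq z a; rewrite ?orbT ?axy.
have A2 : [set z in x ++ [:: a, d & y]] = A.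
  by rewrite -A1; apply/setP => z; rewrite !(inE, mem_cat); congr (_ || _); rewrite orbCA.
have A3 : [set z in x ++ c :: y] :\ c = A.
  apply/setP => z; rewrite !(inE, mem_cat); case: (z =P c) => [->|_] //=.
  by move: cxy; rewrite mem_cat => /negPf->.
rewrite /closed_sum /tripod_sum A1 A2 -sumrB [RHS](big_support (a := c)); last first.
  by rewrite !(inE, mem_cat) ?eqxx orbT.
rewrite A3; apply: eq_bigr => mu muA.
have muc : mu c = ord0 by apply: (support0 muA); rewrite inE.
have cd : d == c = false by apply/negbTE; apply: contraNneq cxy => <-.
have ca : a == c = false by apply/negbTE; apply: contraNneq cxy => <-.
move: cxy; rewrite mem_cat negb_or => /andP[cx cy].
rewrite !big_cat !big_cons /= -mulrzBl -mulrBr !mulrA -mulrBl.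
rewrite JC mulr_suml mulr_sumr mulrz_suml [RHS]big_mkcond /=.
apply: eq_bigr => k _; rewrite big_cat big_cons (prod_update (B := b)) //.
rewrite !(@prod_word_update _ R) // !updateE eqxx cd ca.
case: eqP => [->|_] /=; first by rewrite levi0 !mul0r mulr0 mul0rz.
rewrite mulrzAl mulrzAr -mulrzA; congr (_ *~ _); ring.
Qed.

Lemma J0_central l : J l * J ord0 = J ord0 * J l.
Proof.
apply/eqP; rewrite -subr_eq0 JC big1 // => k _.
by rewrite leviCr leviC levi0 ?oppr0 mul0r mulr0z.
Qed.

(** The quadratic Casimir element of the three-dimensional Lie algebra. *)
Definition casimir3 : R := \sum_(k | k != ord0) (J k * J k) *~ b k.

Lemma casimir3C l : J l * casimir3 = casimir3 * J l.
Proof.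
apply/eqP; rewrite -subr_eq0 mulr_sumr mulr_suml -sumrB.
apply/eqP; rewrite -[RHS](casimir_inv l 1) -[RHS]sum_neq0.
  apply: eq_bigr => k _; rewrite !mulr1 mulrBl mulrBr !mulrA addrA subrK.
  by rewrite mulrzBl mulrzAr mulrzAl !mulrA.
by rewrite J0_central subrr mul0r mul0r mulr0 addr0 mul0rz.
Qed.

Lemma word_casimir3C mu s : wv mu s * casimir3 = casimir3 * wv mu s.
Proof.
elim: s => [|x s IH]; first by rewrite big_nil mulr1 mul1r.
by rewrite big_cons -mulrA IH !mulrA casimir3C.
Qed.

Lemma closed_sum_nil : closed_sum [::] = 1.
Proof.
rewrite /closed_sum (eq_bigl (fun mu => support mu == set0)); last first.
  by move=> mu; congr (_ == _); apply/setP => x; rewrite !inE.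
rewrite big_support0 big_nil big1 ?mulr1z // => x _.
by rewrite ffunE.
Qed.

Lemma closed_sum_isolated x y a : a \notin x ++ y ->
  closed_sum (x ++ [:: a, a & y]) = casimir3 * closed_sum (x ++ y).
Proof.
move=> axy; rewrite /closed_sum mulr_sumr (big_support (a := a)); last first.
  by rewrite !(inE, mem_cat) ?eqxx orbT.
have -> : [set z in x ++ [:: a, a & y]] :\ a = [set z in x ++ y].
  apply/setP => z; rewrite !(inE, mem_cat); have [->|_] //= := eqVneq z a.
  by move: axy; rewrite mem_cat => /negPf->.
apply: eq_bigr => mu muA.
have mua : mu a = ord0 by apply: (support0 muA); rewrite inE.
move: axy; rewrite mem_cat negb_or => /andP[ax ay].
transitivity (wv mu x * casimir3 * wv mu y *~ bw mu); last first.
  by rewrite word_casimir3C big_cat -!mulrA mulrzAr.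
rewrite /casimir3 mulr_sumr mulr_suml mulrz_suml; apply: eq_bigr => k _.
rewrite (prod_update (B := b)) // big_cat !big_cons /= !(@prod_word_update _ R) //.
rewrite !updateE eqxx mulrzAr mulrzAl -mulrzA !mulrA; congr (_ *~ _); ring.
Qed.

Lemma tripod_adjacent x y a d c : a \notin x ++ y -> d \notin x ++ y ->
    c \in x ++ y -> a != d ->
  tripod_sum a d c (x ++ [:: a, d & y]) = closed_sum (x ++ c :: y) *~ - e.
Proof.
move=> axy dxy cxy ad; rewrite /tripod_sum /closed_sum (big_support (a := a)); last first.
  by rewrite !(inE, mem_cat) ?eqxx orbT.
rewrite (big_support (a := d)); last first.
  by rewrite !(inE, mem_cat) ?eqxx (eq_sym d) ad !orbT.
have -> : [set z in x ++ [:: a, d & y]] :\ a :\ d = [set z in x ++ c :: y].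
  apply/setP => z; rewrite !(inE, mem_cat).
  rewrite !mem_cat in axy dxy cxy.
  have [->|_] := eqVneq z d.
    rewrite /= orbCA (negPf dxy) orbF.
    by apply/esym; apply: contraNF dxy => /eqP->.
  have [->|_] /= := eqVneq z a.
    rewrite orbCA (negPf axy) orbF ?andbF.
    by apply/esym; apply: contraNF axy => /eqP->.
  by rewrite orbCA; case: eqP => // ->.
rewrite mulrz_suml; apply: eq_bigr => mu muA.
have mua : mu a = ord0.
  apply: (support0 muA); rewrite !(inE, mem_cat) orbCA -mem_cat (negPf axy) orbF.
  by apply: contraNN axy => /eqP->.
have mud : mu d = ord0.
  apply: (support0 muA); rewrite !(inE, mem_cat) orbCA -mem_cat (negPf dxy) orbF.
  by apply: contraNN dxy => /eqP->.
have muc : mu c != ord0.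
  by apply: (support_neq0 muA); rewrite !(inE, mem_cat) eqxx orbT.
have ac : c == a = false by apply/negbTE; apply: contraNneq axy => <-.
have da : d == a = false by rewrite eq_sym (negPf ad).
have dc : c == d = false by apply/negbTE; apply: contraNneq dxy => <-.
move: axy dxy; rewrite !mem_cat !negb_or => /andP[ax ay] /andP[dx dy].
rewrite big_cat big_cons /=.
transitivity ((wv mu x * (\sum_i \sum_j (J i * J j) *~ (b i * b j * levi i j (mu c)))
   * wv mu y) *~ bw mu); last first.
  rewrite levi_adjacent // mulrzAr mulrzAl -!mulrzA mulrA; congr (_ *~ _); ring.
rewrite exchange_big mulr_sumr mulr_suml mulrz_suml sum_neq0; last first.
  by apply: big1 => k _; rewrite !updateE !eqxx levi0l mulr0 mulr0z.
apply: eq_bigr => i _.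
rewrite mulr_sumr mulr_suml mulrz_suml sum_neq0; last first.
  by rewrite !updateE !eqxx da levi0m mulr0 mulr0z.
apply: eq_bigr => j _.
rewrite (prod_update (B := b)) // ?updateE ?(negPf ad) //.
rewrite (prod_update (B := b)) // big_cat !big_cons /= !(@prod_word_update _ R) //.
rewrite !updateE !eqxx ac dc da.
rewrite mulrzAr mulrzAl -mulrzA !mulrA; congr (_ *~ _); ring.
Qed.

Lemma rename_support x z a b' c d : uniq [:: a; b'; c; d] ->
  b' \notin x ++ z -> a \in x ++ z -> c \in x ++ z -> d \in x ++ z ->
  [set u in x ++ [:: d, b' & z]] :\ b' :\ d
  = [set u in rename d a x ++ c :: rename d a z].
Proof.
rewrite /= !inE !negb_or -!andbA => /and5P[ab ac ad bc /and3P[bd cd _]].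
move=> bxz axz cxz dxz; apply/setP => u.
rewrite !mem_cat in bxz axz cxz dxz.
rewrite !(inE, mem_cat, mem_rename) //.
have [->|ud] /= := eqVneq u d.
  by rewrite eq_sym (negPf ad) eq_sym (negPf cd).
have [->|ub] /= := eqVneq u b'.
  rewrite eq_sym (negPf ab) (negPf bc) /=.
  by rewrite (negPf bxz).
have [->|ua] /= := eqVneq u a.
  rewrite axz; move: dxz.
  by case: (d \in x); case: (d \in z) => //=; rewrite ?orbT.
have [->|uc] //= := eqVneq u c.
by rewrite cxz !orbT.
Qed.

Lemma tripod_exchange x z a b' c d : uniq [:: a; b'; c; d] ->
    b' \notin x ++ z -> a \in x ++ z -> c \in x ++ z -> d \in x ++ z ->
  tripod_sum a b' c (x ++ [:: d, b' & z])
  = tripod_sum a b' c (x ++ [:: b', d & z])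
    + (closed_sum (rename d a x ++ c :: rename d a z)
       - closed_sum (rename d c x ++ a :: rename d c z)) *~ - e.
Proof.
move=> uabcd bxz axz cxz dxz; apply/eqP; rewrite addrC -subr_eq; apply/eqP.
have ucbad : uniq [:: c; b'; a; d].
  move: uabcd; rewrite /= !inE !negb_or (eq_sym c b') (eq_sym c a) (eq_sym b' a).
  by do ![case: eqP => // _].
rewrite /closed_sum -(rename_support uabcd) // -(rename_support ucbad) //.
rewrite /tripod_sum.
have -> : [set u in x ++ [:: b', d & z]] = [set u in x ++ [:: d, b' & z]].
  by apply/setP => u; rewrite !(inE, mem_cat); congr (_ || _); rewrite orbCA.
move: uabcd; rewrite /= !inE !negb_or -!andbA => /and5P[ab ac ad bc /and3P[bd cd _]].
rewrite -!sumrB (big_support (a := b')); last first.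
  by rewrite !(inE, mem_cat) ?eqxx !orbT.
rewrite (big_support (a := d)); last first.
  by rewrite !(inE, mem_cat) eq_sym bd ?eqxx !orbT.
rewrite mulrz_suml; apply: eq_bigr => mu muA.
have mub : mu b' = ord0 by apply: (support0 muA); rewrite !inE eqxx andbF.
have mud : mu d = ord0 by apply: (support0 muA); rewrite !inE eqxx.
have mua : mu a != ord0.
  apply: (support_neq0 muA); rewrite !(inE, mem_cat) ad ab /=.
  by move: axz; rewrite mem_cat => /orP[]->; rewrite ?orbT.
have muc : mu c != ord0.
  apply: (support_neq0 muA); rewrite !(inE, mem_cat) cd (eq_sym c) bc /=.
  by move: cxz; rewrite mem_cat => /orP[]->; rewrite ?orbT.
move: bxz; rewrite mem_cat negb_or => /andP[bx bz].
pose X i := wv (update mu d i) x; pose Z i := wv (update mu d i) z.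
have /(congr1 (fun u => u *~ bw mu)) := levi_exchange X Z mua muc.
rewrite -mulrzA (mulrC (- e)) mulrzA mulrzBl /X /Z !prod_word_rename => lev.
have db : d == b' = false by rewrite eq_sym (negPf bd).
have cb : c == b' = false by rewrite eq_sym (negPf bc).
rewrite !big_cat !big_cons -!mulrzBl /= !mulrA -{}lev.
pose G i j := (wv (update mu d i) x * (J i * J j - J j * J i)
  * wv (update mu d i) z) *~ (b i * b j * levi (mu a) j (mu c)) *~ bw mu.
transitivity (\sum_(i | i != ord0) \sum_(j | j != ord0) G i j).
  apply: eq_bigr => i _; apply: eq_bigr => j _.
  rewrite (prod_update (B := b)) ?updateE ?(eq_sym b') ?db // (prod_update (B := b)) //.
  rewrite !big_cat !big_cons /= !(@prod_word_update _ R _ _ b') // !updateE !eqxx.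
  rewrite db cb (negPf ab) (negPf ad) (negPf cd).
  rewrite /G -mulrzBl -mulrBr !mulrA -mulrBl !mulrA -mulrzA.
  congr (_ *~ _); ring.
rewrite mulrz_suml sum_neq0; last first.
  by apply: big1 => j _; rewrite /G -J0_central subrr mulr0 mul0r !mul0rz.
apply: eq_bigr => i _; rewrite mulrz_suml sum_neq0 //.
by rewrite /G J0_central subrr mulr0 mul0r !mul0rz.
Qed.

(** Every name occurring in the word is a chord with its two ends in it. *)
Definition paired s := forall u, count_mem u s = 0%N \/ count_mem u s = 2%N.

(** Every leg of the vertex occurs once, and every chord twice. *)
Definition tripod_word a d c s :=
  uniq [:: a; d; c] /\ forall u,
    if u \in [:: a; d; c] then count_mem u s = 1%N
    else count_mem u s = 0%N \/ count_mem u s = 2%N.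

Variable P : R -> Prop.
Hypotheses (P1 : P 1) (PB : forall u v, P u -> P v -> P (u - v)).
Hypothesis PC : forall u, P u -> P (casimir3 * u).

(** An unused name, available as long as some name is left. *)
Lemma paired_fresh s : paired s -> (size s < 2 * #|T|)%N -> exists c, c \notin s.
Proof.
move=> s2 ss; apply/existsP; apply: contraLR ss; rewrite -leqNgt negb_exists.
move=> /forallP s_all.
rewrite size_sum_count mulnC -sum_nat_const leq_sum // => u _.
have := s_all u; rewrite negbK => us.
by case: (s2 u) => [/count_memPn|->] //; rewrite us.
Qed.

Let PN u : P u -> P (- u).
Proof. by move=> Pu; rewrite -[- u]add0r -(subrr 1); by apply: (PB _ Pu); apply: PB. Qed.

Let PD u v : P u -> P v -> P (u + v).
Proof. by move=> Pu Pv; rewrite -[v]opprK; apply: PB => //; exact: PN. Qed.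

Let Pe u : P u -> P (u *~ - e).
Proof. by move=> Pu; case: e1 => ->; [exact: PN | rewrite opprK]. Qed.

(** Both kinds of sums lie in the subring generated by the Casimir element. This is
    an induction on the number of letters: moving one end of a chord next to the
    other end, or one leg of a vertex next to another leg, costs only corrections
    with fewer letters. *)
Lemma closed_tripod_sum_in m :
  (forall s, paired s -> size s = m -> (m < 2 * #|T|)%N -> P (closed_sum s)) /\
  (forall a d c x y z, tripod_word a d c (x ++ a :: y ++ d :: z) ->
     size (x ++ a :: y ++ d :: z) = m -> (m < 2 * #|T|)%N ->
     P (tripod_sum a d c (x ++ a :: y ++ d :: z))).
Proof.
elim/ltn_ind: m => m IH; split.
- move=> s; case: s => [|a s] s2 sm mT; first by rewrite closed_sum_nil.
  have as_ : a \in s.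
    have := s2 a; rewrite -has_pred1 has_count /= eqxx; count_lia.
  case/splitPr: as_ s2 sm => u v.
  suff H p : paired (p ++ a :: u ++ a :: v) -> size (p ++ a :: u ++ a :: v) = m ->
      P (closed_sum (p ++ a :: u ++ a :: v)) by exact: (H [::]).
  (* The right end of the chord [a] moves leftwards through [u]. *)
  elim/last_ind: u p v => [|u d IHu] p v s2 sm.
    rewrite closed_sum_isolated; last first.
      by rewrite -has_pred1 has_count; have := s2 a; rewrite !count_cat /= eqxx; count_lia.
    apply: PC; have [|+ _] := IH (size (p ++ v)); first by rewrite -sm !size_cat /=; lia.
    apply=> //; last by move: sm mT; rewrite !size_cat /=; lia.
    move=> x; have := s2 a; have := s2 x; rewrite !count_cat /= eqxx.
    by have [->|ax] := eqVneq a x; count_lia.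
  have [c cs] := paired_fresh s2 (leq_ltn_trans (eq_leq sm) mT).
  have da : d != a.
    apply/eqP => da; have := s2 a.
    by rewrite -cats1 !count_cat /= ?count_cat /= da eqxx; count_lia.
  have E : p ++ a :: rcons u d ++ a :: v = (p ++ a :: u) ++ [:: d, a & v].
    by rewrite -cats1 -!catA.
  rewrite E in s2 sm cs *.
  rewrite mem_cat !inE !negb_or in cs; case/and4P: cs => cx cd ca cv.
  rewrite -[closed_sum _](subrK (closed_sum ((p ++ a :: u) ++ [:: a, d & v]))).
  apply: PD; last first.
    rewrite -catA /=; apply: IHu; last by move: sm; rewrite !size_cat /= ?size_cat /=; lia.
    by move=> x; have := s2 x; rewrite !count_cat /= ?count_cat /=; count_lia.
  rewrite (closed_sum_swap (c := c)) //; last 3 first.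
  + by rewrite mem_cat negb_or cx.
  + rewrite -has_pred1 has_count; have := s2 d.
    by rewrite !count_cat /= ?count_cat /= eqxx; case: (a == d); count_lia.
  + by rewrite !mem_cat mem_head !orbT.
  rewrite -tripod_cyc -catA /=.
  have [|_ +] := IH (size (p ++ a :: u ++ c :: v)).
    by rewrite -sm !size_cat /= ?size_cat /=; lia.
  apply=> //; last by move: sm mT; rewrite !size_cat /= ?size_cat /=; lia.
  move: cx; rewrite mem_cat inE !negb_or => /and3P[cp _ cu].
  split; first by rewrite /= !inE !negb_or (eq_sym a) ca (eq_sym a) da cd.
  move=> x; rewrite !inE.
  have c0 w : c \notin w -> count_mem c w = 0%N by move/count_memPn.
  have := s2 x; have := s2 a; have := s2 d.
  rewrite !count_cat /= ?count_cat /= !eqxx (negPf da) (eq_sym a d) (negPf da).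
  have [->|xa] /= := eqVneq x a.
    by rewrite ?eqxx ?(negPf da) ?(negPf ca) ?(eq_sym a) ?(negPf da) ?(negPf ca); count_lia.
  have [->|xc] /= := eqVneq x c.
    by rewrite ?eqxx !c0 // ?(eq_sym a) ?(negPf ca); count_lia.
  have [->|xd] /= := eqVneq x d; first by rewrite ?eqxx; count_lia.
  by count_lia.
- (* The leg [d] moves leftwards through [y], towards the leg [a]. *)
  move=> a d c x y z; elim/last_ind: y x z => [|y t IHy] x z [adc s12] sm mT.
    have [ad ac dc] : [/\ a != d, a != c & d != c].
      by move: adc; rewrite /= !inE negb_or andbT => /andP[/andP[-> ->] ->].
    have [sa sd sc] := And3 (s12 a) (s12 d) (s12 c).
    rewrite !inE !eqxx ?orbT in sa sd sc.
    rewrite tripod_adjacent //; last 3 first.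
    + rewrite -has_pred1 has_count; move: sa; rewrite !count_cat /= eqxx /=; count_lia.
    + rewrite -has_pred1 has_count; move: sd; rewrite !count_cat /= eqxx /=; count_lia.
    + rewrite -has_pred1 has_count; move: sc.
      by rewrite !count_cat /= (negPf ac) (negPf dc) /=; count_lia.
    apply: Pe; have [|+ _] := IH (size (x ++ c :: z)); first by rewrite -sm !size_cat /=; lia.
    apply=> //; last by move: sm mT; rewrite !size_cat /=; lia.
    move=> u; have := s12 u; move: sa sd sc; rewrite !inE !count_cat /= !eqxx.
    rewrite (negPf ac) (negPf dc) (eq_sym d a) (negPf ad).
    rewrite (eq_sym u c) (eq_sym u a) (eq_sym u d).
    have [<-|_] := eqVneq a u.
      by rewrite (eq_sym c) (negPf ac) (eq_sym d) (negPf ad) /=; count_lia.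
    have [<-|_] := eqVneq d u; first by rewrite (eq_sym c) (negPf dc) /=; count_lia.
    by have [<-|_] := eqVneq c u; rewrite /=; count_lia.
  have E : x ++ a :: rcons y t ++ d :: z = (x ++ a :: y) ++ [:: t, d & z].
    by rewrite -cats1 -!catA.
  rewrite E in s12 sm *; set X := x ++ a :: y in s12 sm E *.
  have [ad ac dc] : [/\ a != d, a != c & d != c].
    by move: adc; rewrite /= !inE negb_or andbT => /andP[/andP[-> ->] ->].
  have [sa sd sc] := And3 (s12 a) (s12 d) (s12 c).
  rewrite !inE !eqxx ?orbT in sa sd sc.
  have [tc|tc] := eqVneq t c.
    rewrite {t}tc in s12 sm sa sd sc E *.
    rewrite -tripod_cyc tripodC; apply: PN; rewrite tripod_adjacent 1?eq_sym //; last 3 first.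
    + by rewrite -has_pred1 has_count; move: sc; rewrite !count_cat /= eqxx; count_lia.
    + by rewrite -has_pred1 has_count; move: sd; rewrite !count_cat /= eqxx; count_lia.
    + by rewrite mem_cat /X mem_cat mem_head orbT.
    apply: Pe; have [|+ _] := IH (size (X ++ a :: z)); first by rewrite -sm !size_cat /=; lia.
    apply=> //; last by move: sm mT; rewrite !size_cat /=; lia.
    move=> u; have := s12 u; move: sa sd sc; rewrite !inE !count_cat /= !eqxx.
    rewrite (eq_sym c a) (eq_sym d a) (negPf ac) (eq_sym c d) (negPf dc) (negPf ad).
    rewrite (eq_sym u c) (eq_sym u a) (eq_sym u d).
    have [<-|_] := eqVneq a u.
      by rewrite (eq_sym c) (negPf ac) (eq_sym d) (negPf ad) /=; count_lia.
    have [<-|_] := eqVneq d u; first by rewrite (eq_sym c) (negPf dc) /=; count_lia.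
    by have [<-|_] := eqVneq c u; rewrite /=; count_lia.
  have ta : a != t.
    apply/eqP => ta; move: sa; rewrite /X !count_cat /= ?count_cat /= ta eqxx /=; count_lia.
  have td : d != t.
    apply/eqP => td; move: sd; rewrite !count_cat /= ?count_cat /= td eqxx /=; count_lia.
  have ct : c != t by rewrite eq_sym.
  have st : count_mem t (X ++ z) = 1%N.
    have := s12 t; rewrite !inE eq_sym (negPf ta) eq_sym (negPf td) eq_sym (negPf ct).
    by rewrite !count_cat /= !eqxx (negPf td) /=; count_lia.
  have sym (p q : T) : p != q -> (p == q = false) * (q == p = false).
    by move=> pq; split; [|rewrite eq_sym]; apply: negPf.
  pose neqs := (sym _ _ ta, sym _ _ td, sym _ _ ct, sym _ _ ad, sym _ _ ac, sym _ _ dc).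
  rewrite tripod_exchange; last 5 first.
  + by rewrite /= !inE !negb_or ad ac ta dc td ct.
  + by rewrite -has_pred1 has_count; move: sd; rewrite !count_cat /= eqxx; count_lia.
  + by rewrite mem_cat /X mem_cat mem_head orbT.
  + rewrite -has_pred1 has_count; move: sc.
    by rewrite !count_cat /= (negPf dc) (negPf tc); count_lia.
  + by rewrite -has_pred1 has_count st.
  apply: PD.
    rewrite /X -catA /=; apply: IHy.
    + split=> // u; have := s12 u; rewrite /X !count_cat /= ?count_cat /=.
      by case: (u \in _) => /=; count_lia.
    + by rewrite -sm /X !size_cat /= ?size_cat /=; lia.
    + by [].
  apply: Pe; apply: PB.
    have [|+ _] := IH (size (rename t a X ++ c :: rename t a z)).
      by rewrite -sm /X !size_cat /= /rename !size_map ?size_cat /=; lia.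
    apply=> //; last first.
      by move: sm mT; rewrite /X !size_cat /= /rename !size_map ?size_cat /=; lia.
    move=> u; have := s12 u; move: sa sd sc st.
    rewrite !inE !count_cat /= !count_rename // /X !count_cat /= !eqxx.
    rewrite !neqs (eq_sym u t) (eq_sym u c) (eq_sym u a) (eq_sym u d).
    have [<-|_] := eqVneq t u; first by rewrite ?neqs /=; count_lia.
    have [<-|_] := eqVneq a u; first by rewrite ?neqs /=; count_lia.
    have [<-|_] := eqVneq c u; first by rewrite ?neqs /=; count_lia.
    by have [<-|_] := eqVneq d u; rewrite /=; count_lia.
  have [|+ _] := IH (size (rename t c X ++ a :: rename t c z)).
    by rewrite -sm /X !size_cat /= /rename !size_map ?size_cat /=; lia.
  apply=> //; last first.
    by move: sm mT; rewrite /X !size_cat /= /rename !size_map ?size_cat /=; lia.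
  move=> u; have := s12 u; move: sa sd sc st.
  rewrite !inE !count_cat /= !count_rename // /X !count_cat /= !eqxx.
  rewrite !neqs (eq_sym u t) (eq_sym u c) (eq_sym u a) (eq_sym u d).
  have [<-|_] := eqVneq t u; first by rewrite ?neqs /=; count_lia.
  have [<-|_] := eqVneq a u; first by rewrite ?neqs /=; count_lia.
  have [<-|_] := eqVneq c u; first by rewrite ?neqs /=; count_lia.
  by have [<-|_] := eqVneq d u; rewrite /=; count_lia.
Qed.

End Words.

Lemma big_update (T : finType) (V : nmodType) (a : T)
    (F : {ffun T -> 'I_4} -> V) :
  \sum_mu F mu = \sum_(mu : {ffun T -> 'I_4} | mu a == ord0) \sum_k F (update mu a k).
Proof.
rewrite (partition_big (fun mu : {ffun T -> 'I_4} => update mu a ord0)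
           (fun mu => mu a == ord0)) /=; last first.
  by move=> mu _; rewrite updateE eqxx.
apply: eq_bigr => mu /eqP mua.
rewrite (reindex_onto (update mu a) (fun nu : {ffun T -> 'I_4} => nu a)) /=.
  apply: eq_bigl => k; rewrite updateE eqxx eqxx andbT; apply/eqP/ffunP => x.
  by rewrite !updateE; case: eqP => // ->.
move=> nu /eqP<-; apply/ffunP => x; rewrite !updateE.
by case: eqP => [->|].
Qed.

(** * The weight of a chord diagram with labels 0, 1, 2, 3 *)

Section FullSum.
Variables (R : nzRingType) (e : int).
Hypothesis e1 : e = 1 \/ e = -1.
Variable J : 'I_4 -> R.
Hypothesis JC : forall i j,
  J i * J j - J j * J i = \sum_k J k *~ (levi i j k * metric e k).
Local Notation b := (metric e).
Variable T : finType.
Implicit Types (mu : {ffun T -> 'I_4}) (a c d : T) (s : seq T).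

Local Notation wv mu s := (\prod_(x <- s) J (mu x)).
Local Notation bw mu := (\prod_x b (mu x)).

(** The Lie algebra weight of a word: the sum over the labellings of all the names. *)
Definition word_sum s : R := \sum_(mu : {ffun T -> 'I_4}) wv mu s *~ bw mu.

(** The commutator of [l] with the word, restricted to the letters satisfying [P]. *)
Definition ad_word l (P : pred T) mu : seq T -> R :=
  fix ad s := if s is x :: s' then
    (if P x then (l * J (mu x) - J (mu x) * l) * wv mu s' else 0) + J (mu x) * ad s'
  else 0.

Lemma ad_word0 l (P : pred T) mu s : (forall x, x \in s -> ~~ P x) -> ad_word l P mu s = 0.
Proof.
elim: s => [|x s IH] //= Ps; rewrite (negPf (Ps x (mem_head _ _))) add0r IH ?mulr0 //.
by move=> y ys; apply: Ps; rewrite inE ys orbT.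
Qed.

Lemma ad_word_cat l P mu s t :
  ad_word l P mu (s ++ t) = ad_word l P mu s * wv mu t + wv mu s * ad_word l P mu t.
Proof.
elim: s => [|x s IH] /=; first by rewrite big_nil mul0r mul1r add0r.
rewrite IH big_cat big_cons /= !mulrDl mulrDr !mulrA addrA.
by case: (P x); rewrite ?mul0r // !mulrDl -!mulrA.
Qed.

Lemma ad_wordT l mu s : ad_word l predT mu s = l * wv mu s - wv mu s * l.
Proof.
elim: s => [|x s IH] /=; first by rewrite big_nil mulr1 mul1r subrr.
by rewrite IH big_cons mulrBl mulrBr !mulrA addrA subrK.
Qed.

Lemma ad_word_sum l mu s : ad_word l predT mu s = \sum_a ad_word l (pred1 a) mu s.
Proof.
elim: s => [|x s IH] /=; first by rewrite big1.
rewrite IH big_split /= mulr_sumr; congr (_ + _).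
rewrite (bigD1 x) //= eqxx [X in _ = _ + X]big1 ?addr0 // => a ax.
by rewrite eq_sym (negPf ax).
Qed.

(** The two ends of the chord [d] contribute opposite commutators. *)
Lemma ad_word_pair p q r a d : a != d -> d \notin p ++ q ++ r ->
  \sum_(mu : {ffun T -> 'I_4})
    ad_word (J (mu a)) (pred1 d) mu (p ++ d :: q ++ d :: r) *~ bw mu = 0.
Proof.
move=> ad dpqr; rewrite (big_update d) big1 // => mu /eqP mud.
move: dpqr; rewrite !mem_cat !negb_or => /and3P[dp dq dr].
transitivity (wv mu p * (\sum_k
    ((J (mu a) * J k - J k * J (mu a)) * wv mu q * J k
          + J k * wv mu q * (J (mu a) * J k - J k * J (mu a))) *~ b k) * wv mu r *~ bw mu);
  last by rewrite casimir_inv // mulr0 mul0r mul0rz.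
rewrite mulr_sumr mulr_suml mulrz_suml; apply: eq_bigr => k _.
rewrite (prod_update (B := b)) // updateE (negPf ad) !ad_word_cat /=.
rewrite !ad_word_cat /= eqxx.
have ad0 l nu w : d \notin w -> ad_word l (pred1 d) nu w = 0.
  by move=> dw; apply: ad_word0 => x; apply: contraTneq => ->.
rewrite !ad0 //.
rewrite !(big_cat, big_cons, big_nil) /=.
rewrite !(@prod_word_update _ R) // !updateE !eqxx.
rewrite !(mulr0, mul0r, addr0, add0r) !mulrzAr !mulrzAl -mulrzA (mulrC (b k)); congr (_ *~ _).
by rewrite !(mulrDr, mulrDl, mulrBr, mulrBl, mulrA, mulrN, mulNr).
Qed.

Lemma word_sum_4T p q r a d : a != d -> d \notin p ++ q ++ r ->
  word_sum (p ++ [:: a; d] ++ q ++ [:: d] ++ r)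
  - word_sum (p ++ [:: d; a] ++ q ++ [:: d] ++ r)
  + word_sum (p ++ [:: d] ++ q ++ [:: a; d] ++ r)
  - word_sum (p ++ [:: d] ++ q ++ [:: d; a] ++ r) = 0.
Proof.
move=> ad dpqr; rewrite -[RHS](ad_word_pair ad dpqr).
rewrite /word_sum -!(sumrB, big_split) /=; apply: eq_bigr => mu _.
move: dpqr; rewrite !mem_cat !negb_or => /and3P[dp dq dr].
have ad0 l w : d \notin w -> ad_word l (pred1 d) mu w = 0.
  by move=> dw; apply: ad_word0 => x; apply: contraTneq => ->.
rewrite !ad_word_cat /= !ad_word_cat /= eqxx !ad0 //.
rewrite !(big_cat, big_cons, big_nil) /= -!mulrzBl -mulrzDl -mulrzBl; congr (_ *~ _).
rewrite !(mulr0, mul0r, addr0, add0r).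
by rewrite !(mulrDr, mulrDl, mulrBr, mulrBl, mulrA, mulrN, mulNr) -!addrA.
Qed.

(** Moving the cut past one endpoint: the difference is the commutator of the letter
    with the rest of the word, to which no chord contributes. *)
Lemma word_sum_rot1 a u v : (forall d, count_mem d (a :: u ++ a :: v) = 2) ->
  word_sum (a :: u ++ a :: v) = word_sum (u ++ a :: v ++ [:: a]).
Proof.
move=> s2; apply/eqP; rewrite -subr_eq0 -sumrB /=; apply/eqP.
transitivity (\sum_(mu : {ffun T -> 'I_4}) \sum_d
    ad_word (J (mu a)) (pred1 d) mu (u ++ a :: v) *~ bw mu).
  apply: eq_bigr => mu _; rewrite -mulrz_suml -ad_word_sum ad_wordT.
  have -> : wv mu (u ++ a :: v ++ [:: a]) = wv mu (u ++ a :: v) * J (mu a).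
    by rewrite -cat_cons catA big_cat big_seq1.
  by rewrite big_cons mulrzBl.
rewrite exchange_big big1 //= => d _.
have [->|da] := eqVneq d a.
  have := s2 a; rewrite /= count_cat /= eqxx => s2a.
  apply: big1 => mu _; rewrite ad_word_cat /= !ad_word0 ?eqxx /=.
  - by rewrite subrr !(mul0r, mulr0, addr0, mul0rz).
  - by move=> x xv; apply: contraTneq xv => ->; apply/count_memPn; move: s2a; count_lia.
  - by move=> x xv; apply: contraTneq xv => ->; apply/count_memPn; move: s2a; count_lia.
have [p [q [r [E dpqr]]]] :
    exists p q r, u ++ a :: v = p ++ d :: q ++ d :: r /\ d \notin p ++ q ++ r.
  have s2d : count_mem d (u ++ a :: v) = 2%N by have := s2 d; rewrite /= eq_sym (negPf da).
  have: d \in u ++ a :: v by rewrite -has_pred1 has_count s2d.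
  move: s2d.
  move=> + du; case/splitPr: du => p0 s; rewrite count_cat /= eqxx => s2d.
  have [dp|ds] : d \in p0 \/ d \in s.
  - by move: s2d; rewrite -!has_pred1 !has_count; count_lia.
  - case/splitPr: dp s2d => p q; rewrite count_cat /= eqxx => s2d.
    exists p, q, s; split; first by rewrite -catA.
    by apply/count_memPn; move: s2d; rewrite !count_cat; count_lia.
  - case/splitPr: ds s2d => q r; rewrite count_cat /= eqxx => s2d.
    exists p0, q, r; split=> //.
    by apply/count_memPn; move: s2d; rewrite !count_cat; count_lia.
by rewrite E ad_word_pair // eq_sym.
Qed.

Lemma word_sum_rot k s : (forall d, count_mem d s = 2) ->
  word_sum (rot k s) = word_sum s.
Proof.
move=> s2; elim: k => [|k IH]; first by rewrite rot0.
have [ks|ks] := ltnP k (size s); last by rewrite rot_oversize // ltnW.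
rewrite rotS //; rewrite -{}IH; have {s2 ks} : forall d, count_mem d (rot k s) = 2.
  by move=> d; rewrite (seq.permP (permEl (perm_rot k s))).
case: (rot k s) => // a t s2.
have at_ : a \in t.
  by have := s2 a; rewrite -has_pred1 has_count /= eqxx; count_lia.
case/splitPr: at_ s2 => u v s2; rewrite rot1_cons word_sum_rot1 //.
by congr word_sum; rewrite -cats1 -catA.
Qed.

Lemma word_sum_perm (p : {perm T}) s : word_sum (map p s) = word_sum s.
Proof.
have pK mu : [ffun x => [ffun y => mu (p y)] (p^-1%g x)] = mu.
  by apply/ffunP => x; rewrite !ffunE permKV.
rewrite [RHS](reindex_onto (fun mu : {ffun T -> 'I_4} => [ffun x => mu (p x)])
  (fun mu : {ffun T -> 'I_4} => [ffun x => mu (p^-1%g x)])) /=; last first.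
  by move=> mu _; apply/ffunP => x; rewrite !ffunE permK.
apply: eq_big => [mu|mu _].
  by apply/esym/eqP/ffunP => x; rewrite !ffunE permKV.
rewrite big_map; congr (_ *~ _); first by apply: eq_bigr => x _; rewrite ffunE.
by rewrite (reindex_perm p) /=; apply: eq_bigr => x _; rewrite ffunE.
Qed.

End FullSum.

(** * Adding and deleting a chord *)

Section Extension.
Variables (n : nat) (a : 'I_n.+1).

(** The labelling of n + 1 chords which gives [k] to the chord [a] and [mu] to the
    others. *)
Definition extend_lab (k : 'I_4) (mu : {ffun 'I_n -> 'I_4}) : {ffun 'I_n.+1 -> 'I_4} :=
  [ffun x => if unlift a x is Some y then mu y else k].

Lemma extend_labE k mu : extend_lab k mu a = k.
Proof. by rewrite ffunE unlift_none. Qed.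

Lemma extend_lab_lift k mu x : extend_lab k mu (lift a x) = mu x.
Proof. by rewrite ffunE liftK. Qed.

Lemma big_extend (V : nmodType) (F : {ffun 'I_n.+1 -> 'I_4} -> V) :
  \sum_mu F mu = \sum_k \sum_mu F (extend_lab k mu).
Proof.
rewrite pair_big /= (reindex_onto
  (fun p : 'I_4 * {ffun 'I_n -> 'I_4} => extend_lab p.1 p.2)
  (fun mu : {ffun 'I_n.+1 -> 'I_4} => (mu a, [ffun x => mu (lift a x)]))) /=; last first.
  move=> mu _; apply/ffunP => x; rewrite ffunE.
  by case: unliftP => [y|] ->; rewrite ?ffunE.
apply: eq_bigl => -[k mu] /=; rewrite extend_labE; apply/eqP; congr (_, _).
by apply/ffunP => x; rewrite ffunE extend_lab_lift.
Qed.

Lemma prod_extend (B : 'I_4 -> int) k mu :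
  \prod_x B (extend_lab k mu x) = B k * \prod_x B (mu x).
Proof.
rewrite (bigD1_ord a) //= extend_labE; congr (_ * _).
by apply: eq_bigr => x _; rewrite extend_lab_lift.
Qed.

End Extension.

Section Diagrams.
Variables (R : nzRingType) (e : int).
Hypothesis e1 : e = 1 \/ e = -1.
Variable J : 'I_4 -> R.
Hypothesis JC : forall i j,
  J i * J j - J j * J i = \sum_k J k *~ (levi i j k * metric e k).
Local Notation b := (metric e).

Lemma word_sum_isolated n (s : seq 'I_n) :
  word_sum e J [:: ord0, ord0 & map (lift ord0) s]
  = (\sum_k (J k * J k) *~ b k) * word_sum e J s.
Proof.
rewrite /word_sum (big_extend ord0) mulr_suml; apply: eq_bigr => k _.
rewrite mulr_sumr; apply: eq_bigr => mu _.
rewrite (prod_extend _ b) !big_cons big_map extend_labE.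
under eq_bigr => x _ do rewrite extend_lab_lift.
by rewrite mulrA mulrzAr mulrzAl -mulrzA.
Qed.

(** The number of the chords labelled 0. *)
Definition nzeros n (mu : {ffun 'I_n -> 'I_4}) := #|[set x | mu x == ord0]|.

(** The weight in which the variable stands for the square of the central generator:
    its exponent is the number of the chords labelled 0. *)
Definition word_poly n (s : seq 'I_n) : {poly R} :=
  \sum_(mu : {ffun 'I_n -> 'I_4})
    (\prod_(x <- s | mu x != ord0) J (mu x) *~ \prod_x b (mu x))%:P * 'X^(nzeros mu).

Lemma nzeros_le n mu : (@nzeros n mu <= n)%N.
Proof. by rewrite -[X in (_ <= X)%N]card_ord max_card. Qed.

Lemma size_word_poly n (s : seq 'I_n) : (size (word_poly s) <= n.+1)%N.
Proof.
apply: (leq_trans (size_sum _ _ _)); apply/bigmax_leqP => mu _.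
apply: (leq_trans (size_polyMleq _ _)); rewrite size_polyXn addnS /=.
apply: (@leq_trans (1 + nzeros mu)%N); first by rewrite leq_add2r size_polyC_leq1.
by rewrite add1n ltnS nzeros_le.
Qed.

Lemma prod_zero_labels n (s : seq 'I_n) (mu : {ffun 'I_n -> 'I_4}) :
  \prod_(x <- s) J (mu x)
  = \prod_(x <- s | mu x != ord0) J (mu x) * J ord0 ^+ count (fun x => mu x == ord0) s.
Proof.
elim: s => [|x s IH]; first by rewrite !big_nil expr0 mulr1.
rewrite !big_cons /= IH; case: eqP => [->|_] /=; last by rewrite mulrA.
rewrite add1n exprS !mulrA; congr (_ * _).
elim: s {IH} => [|y s IH]; first by rewrite !big_nil mulr1 mul1r.
rewrite big_cons; case: ifP => // _.
by rewrite mulrA -(J0_central JC) -mulrA IH mulrA.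
Qed.

Lemma count_zero_labels n (s : seq 'I_n) (mu : {ffun 'I_n -> 'I_4}) :
  (forall d, count_mem d s = 2) -> count (fun x => mu x == ord0) s = (nzeros mu).*2.
Proof.
move=> s2; rewrite count_sum (eq_bigr (fun=> 2%N)) => [|a _]; last exact: s2.
by rewrite sum_nat_const muln2 /nzeros cardsE.
Qed.

(** At the square of J_0 the polynomial takes the value of the full weight: the two ends
    of a chord labelled 0 contribute a central factor each. *)
Lemma horner_word_poly n (s : seq 'I_n) : (forall d, count_mem d s = 2) ->
  (word_poly s).[J ord0 * J ord0] = word_sum e J s.
Proof.
move=> s2; rewrite horner_sum; apply: eq_bigr => mu _.
rewrite hornerCM hornerXn prod_zero_labels count_zero_labels // -muln2 mulnC exprM expr2.
by rewrite mulrzAl.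
Qed.

(** A chord labelled 0 can be deleted, so differentiating amounts to deleting a chord
    in all possible ways. *)
Lemma deriv_word_poly n (s : seq 'I_n.+1) :
  (word_poly s)^`() = \sum_a word_poly (pmap (unlift a) s).
Proof.
rewrite /word_poly raddf_sum /=.
transitivity (\sum_(mu : {ffun 'I_n.+1 -> 'I_4}) \sum_(a | mu a == ord0)
    (\prod_(x <- s | mu x != ord0) J (mu x) *~ \prod_x b (mu x))%:P * 'X^((nzeros mu).-1)).
  apply: eq_bigr => mu _; rewrite deriv_mulC derivXn sumr_const mulrnAr.
  by rewrite /nzeros cardsE.
rewrite (exchange_big_dep predT) //=; apply: eq_bigr => a _.
rewrite big_mkcond (big_extend a) (bigD1 ord0) //= [X in _ + X]big1 ?addr0; last first.
  by move=> k k0; apply: big1 => mu _; rewrite extend_labE (negPf k0).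
apply: eq_bigr => mu _; rewrite extend_labE eqxx.
congr (_%:P * 'X^_); last first.
  rewrite /nzeros (cardsD1 a) !inE extend_labE eqxx /=.
  rewrite -(card_imset _ (@lift_inj _ a)); apply: eq_card => x; rewrite !inE.
  case: (unliftP a x) => [y|] ->; last first.
    by rewrite eqxx; apply/esym/negbTE/imsetP => -[y _ /eqP]; rewrite (negPf (neq_lift _ _)).
  by rewrite eq_sym neq_lift extend_lab_lift mem_imset ?inE //; exact: lift_inj.
rewrite (prod_extend _ b) mul1r; congr (_ *~ _).
elim: s => [|x s IH] /=; first by rewrite !big_nil.
rewrite big_cons IH; case: (unliftP a x) => [y|] -> /=.
  by rewrite big_cons extend_lab_lift.
by rewrite extend_labE eqxx.
Qed.

Lemma support_extend n k (mu : {ffun 'I_n -> 'I_4}) (s : seq 'I_n) :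
  (support (extend_lab ord0 k mu) == [set x in map (lift ord0) s])
  = (k == ord0) && (support mu == [set x in s]).
Proof.
apply/eqP/andP => [/setP E|[/eqP-> /eqP/setP E]].
  split.
    have := E ord0; rewrite !inE extend_labE => k0; apply: negbNE; rewrite k0.
    by apply/mapP => -[y _ /eqP]; rewrite (negPf (neq_lift _ _)).
  apply/eqP/setP => x; have := E (lift ord0 x).
  by rewrite !inE extend_lab_lift mem_map //; exact: lift_inj.
apply/setP => x; rewrite !inE; case: (unliftP ord0 x) => [y|] ->.
  by rewrite extend_lab_lift mem_map; [have := E y; rewrite !inE|exact: lift_inj].
rewrite extend_labE eqxx; apply/esym/negbTE/mapP => -[y _ /eqP].
by rewrite (negPf (neq_lift _ _)).
Qed.

(** An unused name does not change the sum. *)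
Lemma closed_sum_lift n (s : seq 'I_n) :
  closed_sum e J (map (lift ord0) s) = closed_sum e J s.
Proof.
rewrite /closed_sum big_mkcond (big_extend ord0) (bigD1 ord0) //= [X in _ + X]big1.
  rewrite addr0 [RHS]big_mkcond; apply: eq_bigr => mu _.
  rewrite support_extend eqxx /= (prod_extend _ b) mul1r big_map.
  by under eq_bigr => x _ do rewrite extend_lab_lift.
by move=> k k0; apply: big1 => mu _; rewrite support_extend (negPf k0).
Qed.

(** Sorting the labellings by the set [A] of the chords with a nonzero label. *)
Lemma word_poly_closed_sum n (s : seq 'I_n) : (forall d, count_mem d s = 2) ->
  word_poly s = \sum_(A : {set 'I_n})
    (closed_sum e J [seq x <- s | x \in A])%:P * 'X^#|~: A|.
Proof.
move=> s2; rewrite /word_poly (partition_big (@support _) xpredT) //=.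
apply: eq_bigr => A _; rewrite /closed_sum rmorph_sum mulr_suml /=.
apply: eq_big => [mu|mu /eqP<-].
  congr (_ == _); apply/setP => x; rewrite !inE mem_filter.
  by rewrite -[x \in s]has_pred1 has_count s2 andbT.
rewrite big_filter; congr ((_ *~ _)%:P * 'X^_).
  by apply: eq_bigl => x; rewrite inE.
by apply: eq_card => x; rewrite !inE negbK.
Qed.

(** If the Casimir element is in the image of a ring morphism, the coefficients of the
    weight polynomials are too. *)
Section Image.
Variables (S : nzRingType) (f : {rmorphism S -> R}) (y : S).
Hypothesis casimir3E : casimir3 e J = f y.

Lemma closed_sum_image n (s : seq 'I_n) : paired s -> exists p, closed_sum e J s = f p.
Proof.
move=> s2.
(* The extra name makes sure that fresh names never run out. *)
rewrite -closed_sum_lift.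
have s2' : paired (map (lift ord0) s).
  move=> u; rewrite count_map; case: (unliftP ord0 u) => [v|] ->.
    rewrite (eq_count (a2 := pred1 v)) //.
  by left; rewrite (eq_count (a2 := pred0)) ?count_pred0.
have fB u v : (exists p, u = f p) -> (exists p, v = f p) -> exists p, u - v = f p.
  by move=> [p ->] [q ->]; exists (p - q); rewrite rmorphB.
have fC u : (exists p, u = f p) -> exists p, casimir3 e J * u = f p.
  by move=> [p ->]; exists (y * p); rewrite rmorphM casimir3E.
have f1 : exists p, 1 = f p by exists 1; rewrite rmorph1.
have [+ _] := closed_tripod_sum_in e1 JC 'I_n.+1 f1 fB fC (size (map (lift ord0) s)).
apply=> //; rewrite size_map card_ord.
apply: (@leq_ltn_trans (2 * n)%N); last by rewrite ltn_pmul2l.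
rewrite size_sum_count -[X in (_ * X)%N]card_ord mulnC -sum_nat_const leq_sum // => u _.
by case: (s2 u) => ->.
Qed.

Lemma word_poly_image n (s : seq 'I_n) : (forall d, count_mem d s = 2) ->
  exists p : {poly S}, word_poly s = map_poly f p.
Proof.
move=> s2; rewrite word_poly_closed_sum //.
elim/big_ind: _ => [|_ _ [p ->] [q ->]|A _].
- by exists 0; rewrite rmorph0.
- by exists (p + q); rewrite rmorphD.
have [|p ->] := @closed_sum_image _ [seq x <- s | x \in A].
  move=> u; rewrite count_filter.
  have [uA|uA] := boolP (u \in A); [right|left].
    rewrite -[RHS](s2 u); apply: eq_count => x /=.
    by case: eqP => // ->; rewrite uA.
  rewrite (eq_count (a2 := pred0)) ?count_pred0 // => x /=.
  by case: eqP => // ->; rewrite (negPf uA).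
by exists (p%:P * 'X^#|~: A|); rewrite rmorphM /= map_polyC map_polyXn.
Qed.
End Image.

End Diagrams.

(** * The twist *)

Lemma ord2_ind (P : 'I_2 -> Prop) : P ord0 -> P ord_max -> forall i, P i.
Proof. by move=> P0 P1 [[|[|k]] lk] //; [move: P0|move: P1]; congr P; apply: val_inj. Qed.

(** Two anticommuting involutions. *)
Definition pauliX : 'M[int]_2 := \matrix_(i, j) (i != j)%:R.
Definition pauliZ : 'M[int]_2 := \matrix_(i, j) ((i == j)%:R * (-1) ^+ i).

Lemma pauliXX : pauliX * pauliX = 1.
Proof.
apply/matrixP; elim/ord2_ind; elim/ord2_ind; by rewrite mxE big_ord_recl big_ord1 !mxE.
Qed.

Lemma pauliZZ : pauliZ * pauliZ = 1.
Proof.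
apply/matrixP; elim/ord2_ind; elim/ord2_ind; by rewrite mxE big_ord_recl big_ord1 !mxE.
Qed.

Lemma pauliXZ : pauliX * pauliZ = - (pauliZ * pauliX).
Proof.
apply/matrixP; elim/ord2_ind; elim/ord2_ind; by rewrite !mxE !big_ord_recl !big_ord0 !mxE.
Qed.

(** A projective representation of Z_2 x Z_2 by anticommuting integral matrices. *)
Definition pauli (p q : bool) : 'M[int]_2 := pauliZ ^+ q * pauliX ^+ p.

Lemma pauliM p q p' q' :
  pauli p q * pauli p' q' = pauli (p (+) p') (q (+) q') *~ (-1) ^+ (p && q').
Proof.
rewrite /pauli; case: p; case: q; case: p'; case: q' => /=;
  rewrite ?(expr0, expr1, mulr1, mul1r) ?mulrN1z ?mulr1z //;
  rewrite ?pauliZZ ?pauliXX // ?mulrA ?pauliZZ ?mul1r //.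
all: rewrite -?(mulrA _ pauliX pauliZ) ?pauliXZ ?mulrN ?mulNr ?mulrA ?pauliZZ ?mul1r
  -?mulrA ?pauliXX ?mulr1 //.
Qed.

(** The degree of the generator Q_k, in Z_2 x Z_2. *)
Definition deg1 (k : 'I_4) := (val k == 1%N) || (val k == 3%N).
Definition deg2 (k : 'I_4) := (val k == 2%N) || (val k == 3%N).
(** The cocycle of the projective representation. *)
Definition cocycle (j k : 'I_4) : int := (-1) ^+ (deg1 j && deg2 k).

Lemma cocycle_sqr j k : cocycle j k ^+ 2 = 1.
Proof. by rewrite /cocycle; case: (_ && _). Qed.

Definition pauli_lab (k : 'I_4) := pauli (deg1 k) (deg2 k).

Section Cocycle.
Variables (T : finType) (mu : T -> 'I_4).
Implicit Types (s : seq T).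

(** The number of the pairs of positions i < j holding [d] and [f] respectively. *)
Fixpoint npairs (d f : T) s : nat :=
  if s is x :: s' then ((x == d) * count_mem f s' + npairs d f s')%N else 0%N.

(** The product of the cocycle over all pairs of positions i < j. *)
Fixpoint pair_cocycle s : int :=
  if s is x :: s' then (\prod_(y <- s') cocycle (mu x) (mu y)) * pair_cocycle s' else 1.

Lemma prod_pauli s : \prod_(x <- s) pauli_lab (mu x) =
  pauli (odd (count (deg1 \o mu) s)) (odd (count (deg2 \o mu) s)) *~ pair_cocycle s.
Proof.
elim: s => [|x s IH]; first by rewrite big_nil /pauli !expr0 mulr1 mulr1z.
rewrite big_cons IH mulrzAr pauliM -mulrzA /= !oddD !oddb; congr (_ *~ (_ * _)).
rewrite /cocycle; elim: s {IH} => [|y s IH]; first by rewrite big_nil andbF.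
rewrite big_cons -IH -signr_addb /= oddD oddb; congr (_ ^+ _).
by case: (deg1 _) => //=; rewrite addbC.
Qed.

Lemma prod_count (S : comRingType) (F : T -> S) s :
  \prod_(x <- s) F x = \prod_d F d ^+ count_mem d s.
Proof.
elim: s => [|x s IH]; first by rewrite big_nil big1.
rewrite big_cons IH; under [RHS]eq_bigr do rewrite /= exprD.
rewrite big_split /=; congr (_ * _).
rewrite (bigD1 x) //= eqxx expr1 big1 ?mulr1 // => d dx.
by rewrite eq_sym (negPf dx).
Qed.

Lemma pair_cocycleE s :
  pair_cocycle s = \prod_d \prod_f cocycle (mu d) (mu f) ^+ npairs d f s.
Proof.
elim: s => [|x s IH] /=; first by rewrite big1 // => d _; rewrite big1.
rewrite IH prod_count; under [RHS]eq_bigr do under eq_bigr do rewrite exprD.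
under [RHS]eq_bigr do rewrite big_split.
rewrite big_split /=; congr (_ * _).
rewrite [RHS](bigD1 x) //= [X in _ = _ * X]big1 ?mulr1.
  by apply: eq_bigr => d _; rewrite eqxx mul1n.
by move=> d dx; rewrite big1 // => f _; rewrite eq_sym (negPf dx).
Qed.

Lemma npairs_filter d f s (P : pred T) : P d -> P f ->
  npairs d f [seq x <- s | P x] = npairs d f s.
Proof.
move=> Pd Pf; elim: s => //= x s IH; case: ifP => Px /=; rewrite IH.
  congr (_ * _ + _)%N; rewrite count_filter; apply: eq_count => y /=.
  by case: eqP => // ->.
by case: eqP => // xd; rewrite -xd Px in Pd.
Qed.

Lemma npairs_diag d s : npairs d d s = 'C(count_mem d s, 2).
Proof.
elim: s => //= x s ->; case: eqP => _; last by rewrite mul0n.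
by rewrite mul1n add1n binS bin1 addnC.
Qed.

End Cocycle.

Lemma diag_count n (D : diag n) x : count_mem x D = 2.
Proof. by case: D => s /= /forallP/(_ x)/eqP. Qed.

(** The parity distinguishes intersecting chords: it is read on the six words with
    two letters [d] and two letters [f]. *)
Lemma npairs_chords n (D : diag n) d f : d != f ->
  let N := npairs d f D in let N' := npairs f d D in
  (odd N = intersect D d f) /\ (odd N' = intersect D d f).
Proof.
move=> df /=; have fd : f == d = false by rewrite eq_sym (negPf df).
pose P := [pred x | (x == d) || (x == f)].
rewrite -(@npairs_filter _ d f _ P) ?inE ?eqxx ?orbT //.
rewrite -(@npairs_filter _ f d _ P) ?inE ?eqxx ?orbT //.
rewrite /intersect.
have c2 x : P x -> count_mem x [seq x <- D | P x] = 2.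
  move=> Px; rewrite count_filter.
  rewrite -[RHS](diag_count D x); apply: eq_count => y /=.
  by case: eqP => // ->; exact: Px.
have sP : all P [seq x <- D | P x] by apply: filter_all.
move: [seq x <- D | _] c2 sP => s c2 sP.
have s4 : size s = 4.
  have cI : count (predI (pred1 d) (pred1 f)) s = 0%N.
    rewrite (eq_count (a2 := pred0)) ?count_pred0 // => x /=.
    by apply/negbTE/andP => -[/eqP->]; rewrite (negPf df).
  have := count_predUI (pred1 d) (pred1 f) s.
  rewrite cI addn0 (eq_count (a2 := P)) // => E.
  by apply/eqP; rewrite -(eqP (etrans (esym (all_count P s)) sP)) E !c2 //= eqxx ?orbT.
have := c2 d; have := c2 f; rewrite !inE !eqxx orbT => /(_ isT) + /(_ isT).
case: s s4 sP {c2} => [|x1 [|x2 [|x3 [|x4 [|]]]]] //= _.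
case/and5P => /orP[]/eqP-> /orP[]/eqP-> /orP[]/eqP-> /orP[]/eqP-> _;
by rewrite !eqseq_cons ?eqxx ?(negPf df) ?fd.
Qed.

Lemma cocycle_odd j k m : cocycle j k ^+ m = cocycle j k ^+ odd m.
Proof.
by rewrite -{1}(odd_double_half m) exprD -mul2n exprM cocycle_sqr expr1n mulr1.
Qed.

(** The sign of the ordered product of the matrices attached to the endpoints. *)
Lemma pair_cocycle_diag n (D : diag n) (mu : 'I_n -> 'I_4) :
  pair_cocycle mu D = (\prod_d cocycle (mu d) (mu d)) *
    \prod_(d < n) \prod_(f < n | (d < f)%N && intersect D d f)
      (cocycle (mu d) (mu f) * cocycle (mu f) (mu d)).
Proof.
rewrite pair_cocycleE.
pose G d f := cocycle (mu d) (mu f) ^+ npairs d f D.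
transitivity (\prod_(d < n) (G d d * ((\prod_(f < n | (d < f)%N) G d f) *
                                (\prod_(f < n | (f < d)%N) G d f)))).
  apply: eq_bigr => d _; rewrite (bigD1 d) //=; congr (_ * _).
  rewrite (bigID (fun f : 'I_n => (d < f)%N)) /=; congr (_ * _).
    by apply: eq_bigl => f; rewrite -val_eqE /=; case: ltngtP.
  by apply: eq_bigl => f; rewrite -val_eqE /=; case: ltngtP.
rewrite !big_split /=; congr (_ * _).
  by apply: eq_bigr => d _; rewrite /G npairs_diag diag_count.
rewrite [X in _ * X](exchange_big_dep predT) //= -big_split; apply: eq_bigr => d _ /=.
rewrite -big_split /= [RHS]big_mkcondr; apply: eq_bigr => f df.
have dNf : d != f by rewrite -val_eqE neq_ltn df.
have [h1 h2] := npairs_chords D dNf.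
rewrite /G (cocycle_odd _ _ (npairs d f D)) (cocycle_odd _ _ (npairs f d D)) h1 h2.
by case: intersect; rewrite ?expr1 // expr0 mulr1.
Qed.

Lemma sum_levi (V : zmodType) (F : 'I_4 -> V) (c : 'I_4 -> int) i j k :
  levi i j k != 0 ->
  \sum_m F m *~ (levi i j m * c m) = F k *~ (levi i j k * c k).
Proof.
move=> ijk; rewrite (bigD1 k) //= big1 ?addr0 // => m mk.
suff -> : levi i j m = 0 by rewrite mul0r mulr0z.
by elim/ord4_ind: i ijk; elim/ord4_ind: j => //; elim/ord4_ind: k mk => //;
  elim/ord4_ind: m.
Qed.

(** * The twisted generators *)

Section Env.
Local Open Scope quotient_scope.
Variables (K : fieldType) (eps : K).
Local Notation A := (A1env eps).
Local Notation Qg := (Q eps).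

Lemma piM (x y : free_alg K 'I_4) :
  \pi_(alg_quot (A1_two_sided eps)) (x * y)
  = (\pi_(alg_quot (A1_two_sided eps)) x : A) * \pi_(alg_quot (A1_two_sided eps)) y.
Proof. exact: alg_quot_piM. Qed.

Lemma piD (x y : free_alg K 'I_4) :
  \pi_(alg_quot (A1_two_sided eps)) (x + y)
  = (\pi_(alg_quot (A1_two_sided eps)) x : A) + \pi_(alg_quot (A1_two_sided eps)) y.
Proof. exact: alg_quot_piD. Qed.

Lemma piZ k (x : free_alg K 'I_4) :
  \pi_(alg_quot (A1_two_sided eps)) (k *: x)
  = k *: (\pi_(alg_quot (A1_two_sided eps)) x : A).
Proof. exact: alg_quot_piZ. Qed.

Lemma pi_rel (l r : free_alg K 'I_4) : A1_rel eps l r ->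
  \pi_(alg_quot (A1_two_sided eps)) l = \pi_(alg_quot (A1_two_sided eps)) r.
Proof.
move=> lr; apply/eqP; rewrite alg_quotE; apply/gen_idealP; exact: gen_ideal_rel.
Qed.

Lemma Q0C k : Qg o0 * Qg k = Qg k * Qg o0.
Proof. by rewrite /Q -!piM; apply: pi_rel; exact: A1_rel_H. Qed.

Lemma Q12 : Qg o1 * Qg o2 + Qg o2 * Qg o1 = Qg o3.
Proof. by rewrite /Q -!piM -piD; apply: pi_rel; exact: A1_rel_12. Qed.

Lemma Q23 : Qg o2 * Qg o3 + Qg o3 * Qg o2 = eps *: Qg o1.
Proof. by rewrite /Q -!piM -piD -piZ; apply: pi_rel; exact: A1_rel_23. Qed.

Lemma Q31 : Qg o3 * Qg o1 + Qg o1 * Qg o3 = Qg o2.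
Proof. by rewrite /Q -!piM -piD; apply: pi_rel; exact: A1_rel_31. Qed.

Local Notation R := ('M[A]_2).
(** The integral matrices, with entries in the enveloping algebra. *)
Definition twist_mx (m : 'M[int]_2) : R := map_mx (intr : int -> A) m.
HB.instance Definition _ := GRing.RMorphism.copy twist_mx (map_mx (intr : int -> A)).

(** Tensoring the generators with the matrices of their degrees turns the
    anticommutators into commutators. *)
Definition twisted (k : 'I_4) : R := (Qg k)%:M * twist_mx (pauli_lab k).

Lemma twist_mxC (x : A) m : twist_mx m * x%:M = x%:M * twist_mx m.
Proof.
rewrite -!mulmxE mul_scalar_mx; apply/matrixP => i j.
rewrite !mxE (bigD1 j) //= big1 => [|k kj]; rewrite !mxE ?eqxx ?addr0 ?mulr1n.
  by rewrite mulrzl mulrzr.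
by rewrite (negPf kj) mulr0n mulr0.
Qed.

Variable e : int.
Hypothesis epsE : eps = e%:~R.

Lemma pauli_labM j k : pauli_lab j * pauli_lab k
  = pauli (deg1 j (+) deg1 k) (deg2 j (+) deg2 k) *~ cocycle j k.
Proof. exact: pauliM. Qed.

Lemma twistedM j k : twisted j * twisted k
  = (Qg j * Qg k *~ cocycle j k)%:M * twist_mx (pauli (deg1 j (+) deg1 k) (deg2 j (+) deg2 k)).
Proof.
rewrite /twisted mulrA -(mulrA _ (twist_mx _)) twist_mxC !mulrA -mulrA -!rmorphM /=.
by rewrite pauli_labM !raddfMz mulrzAl mulrzAr.
Qed.

Lemma scalar_mxMz (x : A) m : (x *~ m)%:M = (x%:M : R) *~ m.
Proof. exact: raddfMz. Qed.

Lemma twistedC i j :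
  twisted i * twisted j - twisted j * twisted i
  = \sum_k twisted k *~ (levi i j k * metric e k).
Proof.
have anti i' j' k' : (deg1 i' (+) deg1 j', deg2 i' (+) deg2 j') = (deg1 k', deg2 k') ->
    twisted i' * twisted j' - twisted j' * twisted i'
    = (Qg i' * Qg j' *~ cocycle i' j' - Qg j' * Qg i' *~ cocycle j' i')%:M
      * twist_mx (pauli_lab k').
  move=> [h1 h2]; rewrite !twistedM (addbC (deg1 j')) (addbC (deg2 j')) h1 h2.
  by rewrite -mulrBl raddfB.
have [->|ij] := eqVneq i j.
  rewrite subrr big1 // => k _.
  by rewrite (_ : levi j j k = 0) ?mul0r //; elim/ord4_ind: j; elim/ord4_ind: k.
have H0 k : twisted o0 * twisted k - twisted k * twisted o0 = 0.
  rewrite !twistedM Q0C (addbC (deg1 k)) (addbC (deg2 k)).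
  by rewrite /cocycle /deg1 /deg2 /= andbF subrr.
have H0' k : twisted k * twisted o0 - twisted o0 * twisted k = 0.
  by rewrite -opprB H0 oppr0.
have Hp i' j' k' x : Qg i' * Qg j' + Qg j' * Qg i' = x ->
    (deg1 i' (+) deg1 j', deg2 i' (+) deg2 j') = (deg1 k', deg2 k') ->
    cocycle i' j' = 1 -> cocycle j' i' = -1 ->
    twisted i' * twisted j' - twisted j' * twisted i' = x%:M * twist_mx (pauli_lab k').
  move=> <- /anti -> -> ->.
  by rewrite mulr1z mulrN1z opprK.
have Hn i' j' k' x : Qg i' * Qg j' + Qg j' * Qg i' = x ->
    (deg1 i' (+) deg1 j', deg2 i' (+) deg2 j') = (deg1 k', deg2 k') ->
    cocycle i' j' = -1 -> cocycle j' i' = 1 ->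
    twisted i' * twisted j' - twisted j' * twisted i' = - (x%:M * twist_mx (pauli_lab k')).
  move=> xE h c1 c2; rewrite -opprB; congr (- _); apply: Hp => //.
    by rewrite addrC.
  by rewrite addbC [X in (_, X)]addbC.
have eQ : (eps *: Qg o1)%:M * twist_mx (pauli_lab o1) = twisted o1 *~ e.
  have -> : eps *: Qg o1 = Qg o1 *~ e by rewrite -scaler_int -epsE.
  by rewrite raddfMz mulrzAl.
have [->|i0] := eqVneq i o0.
  by rewrite H0 big1 // => k _; rewrite ord4_0E levi0l mul0r mulr0z.
have [->|j0] := eqVneq j o0.
  by rewrite H0' big1 // => k _; rewrite ord4_0E levi0m mul0r mulr0z.
elim/ord4_ind: i ij i0 => //; elim/ord4_ind: j j0 => // _ _ _.
- by rewrite (sum_levi _ _ (k := o3)) // (Hn _ _ o3 _ Q12) // mul1r mulrN1z.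
- by rewrite (sum_levi _ _ (k := o2)) // (Hn _ _ o2 (Qg o2)) ?mulr1 ?mulrN1z // addrC Q31.
- by rewrite (sum_levi _ _ (k := o3)) // (Hp _ _ o3 (Qg o3)) ?mulrNN ?mulr1z // addrC Q12.
- by rewrite (sum_levi _ _ (k := o1)) // (Hp _ _ o1 _ Q23) // eQ mul1r.
- by rewrite (sum_levi _ _ (k := o2)) // (Hp _ _ o2 _ Q31) // mul1r mulr1z.
- rewrite (sum_levi _ _ (k := o1)) //.
  by rewrite (Hn _ _ o1 (eps *: Qg o1)) ?eQ ?mulN1r ?mulrNz // addrC Q23.
Qed.

Lemma prod_twisted (T : finType) (mu : T -> 'I_4) (s : seq T) :
  \prod_(x <- s) twisted (mu x)
  = (\prod_(x <- s) Qg (mu x))%:M * twist_mx (\prod_(x <- s) pauli_lab (mu x)).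
Proof.
elim: s => [|x s IH]; first by rewrite !big_nil !rmorph1 mulr1.
rewrite !big_cons IH /twisted mulrA -(mulrA _ (twist_mx _)) twist_mxC !mulrA -mulrA.
by rewrite -!rmorphM.
Qed.

Lemma cocycle_diag_metric k : ((cocycle k k * metric e k)%:~R : K) = bcoef eps k.
Proof. by elim/ord4_ind: k; rewrite /cocycle /metric /bcoef /= ?mul1r ?epsE. Qed.

Lemma cocycle_sigma j k : ((cocycle j k * cocycle k j)%:~R : K) = sigma K j k.
Proof. by elim/ord4_ind: j; elim/ord4_ind: k. Qed.

Lemma even_labels n (D : diag n) (P : pred 'I_n) : odd (count P D) = false.
Proof.
rewrite count_sum (eq_bigr (fun=> 2%N)) => [|a _]; last exact: diag_count.
by rewrite sum_nat_const oddM andbF.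
Qed.

(** The signs of the graded weight system are exactly those of the products of the
    matrices, so the twist turns it into a Lie algebra weight system. *)
Lemma word_sum_weight n (D : diag n) : word_sum e twisted D = (weight eps D)%:M.
Proof.
rewrite /word_sum /weight raddf_sum /=; apply: eq_bigr => mu _.
rewrite prod_twisted prod_pauli !even_labels raddfMz /= mulrzAr -mulrzA.
have -> : pauli false false = 1 by rewrite /pauli !expr0 mulr1.
rewrite rmorph1 mulr1.
transitivity ((\prod_(x <- D) Qg (mu x) *~
  (pair_cocycle mu D * \prod_x metric e (mu x)))%:M : R).
  by rewrite scalar_mxMz.
apply: (congr1 (@scalar_mx A 2)); apply: etrans (esym (scaler_int _ _)) _.
apply: (@congr1 K A (fun k => k *: \prod_(x <- D) Qg (mu x))).
rewrite pair_cocycle_diag mulrAC -big_split /= intrM rmorph_prod; congr (_ * _).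
  by apply: eq_bigr => d _; rewrite -cocycle_diag_metric.
rewrite rmorph_prod; apply: eq_bigr => d _.
by rewrite rmorph_prod; apply: eq_bigr => f _; rewrite -cocycle_sigma.
Qed.

End Env.

(** * Algebraic independence of c and y *)

Section FreeAction.
Variables (K : fieldType) (I : choiceType) (V : lmodType K).
Variable O : I -> {linear V -> V}.
Local Notation F := (free_alg K I).

(** A word acts by the composite of the operators of its letters. *)
Definition mon_act (m : {fmonom I}) (v : V) : V := foldr (fun i => O i) v m.

Fact mon_act_linear m : linear (mon_act m).
Proof.
move=> k u v; rewrite /mon_act; elim: (fmonom_val m) => //= i s IH.
by rewrite IH linearP.
Qed.
HB.instance Definition _ m := GRing.isLinear.Build K V V *:%R (mon_act m) (mon_act_linear m).

(** The action of the free algebra on V by the operators [O i]. *)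
Definition act (g : F) (v : V) : V :=
  \sum_(m <- msupp (g : {malg K[{fmonom I}]})) mcoeff m g *: mon_act m v.

Lemma actEw (d : {fset {fmonom I}}) (g : F) v :
  (msupp (g : {malg K[{fmonom I}]}) `<=` d)%fset ->
  act g v = \sum_(m <- d) mcoeff m g *: mon_act m v.
Proof.
move=> le; rewrite [LHS](big_fset_incl _ le) => //= x xd /mcoeff_outdom ->.
by rewrite scale0r.
Qed.

Lemma actU c m v : act << c *g m >> v = c *: mon_act m v.
Proof. by rewrite (actEw _ msuppU_le) big_seq_fset1 mcoeffUU. Qed.

Lemma actB g h v : act (g - h) v = act g v - act h v.
Proof.
pose E := (msupp (g : {malg K[{fmonom I}]}) `|` msupp (h : {malg K[{fmonom I}]}))%fset.
rewrite (@actEw E g) ?fsubsetUl // (@actEw E h) ?fsubsetUr //.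
rewrite (@actEw E (g - h)) ?msuppB_le // -sumrB.
by apply: eq_bigr => m _; rewrite mcoeffB scalerBl.
Qed.

Lemma act0 v : act 0 v = 0.
Proof. by rewrite -(subrr 0) actB subrr. Qed.

Lemma actD g h v : act (g + h) v = act g v + act h v.
Proof.
have -> : g + h = g - (0 - h) by rewrite sub0r opprK.
by rewrite !actB act0 sub0r opprK.
Qed.

Lemma act_sum J (r : seq J) P (G : J -> F) v :
  act (\sum_(j <- r | P j) G j) v = \sum_(j <- r | P j) act (G j) v.
Proof. by apply: (big_morph (fun g => act g v)) => [g h|]; rewrite ?actD ?act0. Qed.

Lemma actM g h v : act (g * h) v = act g (act h v).
Proof.
rewrite [g * h]malgME act_sum [RHS]/act; apply: eq_bigr => m _.
rewrite act_sum [in RHS]/act linear_sum scaler_sumr; apply: eq_bigr => m' _.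
rewrite actU linearZ scalerA; congr (_ *: _).
by rewrite /mon_act fmM foldr_cat.
Qed.

Lemma actZ k g v : act (k *: g) v = k *: act g v.
Proof.
rewrite (@actEw (msupp (g : {malg K[{fmonom I}]})) (k *: g)) ?msuppZ_le //.
rewrite /act scaler_sumr; apply: eq_bigr => m _; rewrite scalerA; congr (_ *: _).
exact: mcoeffZ.
Qed.

Lemma act_gen i v : act (free_gen K i) v = O i v.
Proof. by rewrite actU scale1r /mon_act /fmu fmE. Qed.

Lemma act_gen2 i j v : act (free_gen K i * free_gen K j) v = O i (O j v).
Proof. exact: etrans (actM _ _ _) (etrans (act_gen _ _) (congr1 (O i) (act_gen j v))). Qed.

Lemma act1 v : act 1 v = v.
Proof. by rewrite actU scale1r /mon_act fm1. Qed.

Lemma act_linear g : linear (act g).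
Proof.
move=> k u v; rewrite /act scaler_sumr -big_split; apply: eq_bigr => m _ /=.
by rewrite linearP scalerDr !scalerA mulrC.
Qed.
HB.instance Definition _ g := GRing.isLinear.Build K V V *:%R (act g) (act_linear g).

End FreeAction.

Section EnvAction.
Local Open Scope quotient_scope.
Variables (K : fieldType) (eps : K) (V : lmodType K) (O : 'I_4 -> {linear V -> V}).
Hypothesis O0C : forall k v, O o0 (O k v) = O k (O o0 v).
Hypothesis O12 : forall v, O o1 (O o2 v) + O o2 (O o1 v) = O o3 v.
Hypothesis O23 : forall v, O o2 (O o3 v) + O o3 (O o2 v) = eps *: O o1 v.
Hypothesis O31 : forall v, O o3 (O o1 v) + O o1 (O o3 v) = O o2 v.

Local Notation A := (A1env eps).
Local Notation pi := (\pi_(alg_quot (A1_two_sided eps))).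

Lemma act_ideal g v : gen_ideal (A1_rel eps) g -> act O g v = 0.
Proof.
move=> gI; elim: gI v => {g} [l r|v|x y _ IHx _ IHy v|a x _ IH v|a x _ IH v].
- move=> lr v; rewrite actB; apply/eqP; rewrite subr_eq0; apply/eqP.
  have h i j i' j' : act O (free_gen K i * free_gen K j + free_gen K i' * free_gen K j') v
      = O i (O j v) + O i' (O j' v).
    exact: etrans (actD O _ _ v) (congr2 +%R (act_gen2 O i j v) (act_gen2 O i' j' v)).
  case: lr => [k|||].
  + exact: etrans (act_gen2 O o0 k v) (etrans (O0C k v) (esym (act_gen2 O k o0 v))).
  + exact: etrans (h _ _ _ _) (etrans (O12 v) (esym (act_gen O o3 v))).
  + apply: etrans (h _ _ _ _) (etrans (O23 v) _).
    by apply: etrans (esym (actZ O eps _ v)); rewrite act_gen.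
  + exact: etrans (h _ _ _ _) (etrans (O31 v) (esym (act_gen O o2 v))).
- exact: act0.
- by rewrite actB IHx IHy subrr.
- by rewrite actM IH linear0.
- by rewrite actM IH.
Qed.

(** Operators satisfying the relations define an action of the enveloping algebra;
    the choice of the representative does not matter by [env_act_pi]. *)
Definition env_act (u : A) (v : V) : V := act O (repr u) v.

Lemma env_act_pi g v : env_act (pi g) v = act O g v.
Proof.
apply/eqP; rewrite -subr_eq0 -actB act_ideal //.
rewrite -opprB -[- _]sub0r; apply: gen_ideal_B; first exact: gen_ideal_0.
by apply/gen_idealP; exact: alg_quot_repr.
Qed.

Lemma env_actD u u' v : env_act (u + u') v = env_act u v + env_act u' v.
Proof. by rewrite -[u]reprK -[u']reprK -piD !env_act_pi actD. Qed.

Lemma env_actM u u' v : env_act (u * u') v = env_act u (env_act u' v).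
Proof. by rewrite -[u]reprK -[u']reprK -piM !env_act_pi actM. Qed.

Lemma env_actZ k u v : env_act (k *: u) v = k *: env_act u v.
Proof. by rewrite -[u]reprK -piZ !env_act_pi actZ. Qed.

Lemma env_actQ i v : env_act (Q eps i) v = O i v.
Proof. by rewrite env_act_pi act_gen. Qed.

Lemma env_act0 v : env_act 0 v = 0.
Proof. by rewrite -(scale0r (0 : A)) env_actZ scale0r. Qed.

Lemma env_act1 v : env_act 1 v = v.
Proof.
have -> : (1 : A) = pi 1 by rewrite [LHS]/1%R /= /alg_quot_one; unlock.
by rewrite env_act_pi act1.
Qed.

Lemma env_act_scale u k v : env_act u (k *: v) = k *: env_act u v.
Proof. exact: linearZ. Qed.

Lemma eval_cy_act (p : {poly {poly K}}) (gam eta : K) v :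
  env_act (casimir eps) v = gam *: v -> env_act (y_elt eps) v = eta *: v ->
  env_act (eval_cy eps p) v = (map_poly (horner_eval eta) p).[gam] *: v.
Proof.
move=> cv yv.
have hy q : env_act (horner_alg (y_elt eps) q) v = q.[eta] *: v.
  elim/poly_ind: q => [|q k IH]; first by rewrite rmorph0 env_act0 horner0 scale0r.
  rewrite rmorphD rmorphM /= horner_algX horner_algC env_actD env_actM yv.
  rewrite env_act_scale IH env_actZ env_act1 hornerMXaddC scalerDl scalerA.
  by rewrite mulrC.
elim/poly_ind: p => [|p q IH].
  by rewrite /eval_cy !rmorph0 !horner0 env_act0 scale0r.
rewrite /eval_cy !rmorphD !rmorphM /= !map_polyX !map_polyC /= !hornerMXaddC.
rewrite env_actD env_actM cv env_act_scale hy [env_act _ v]IH scalerDl scalerA.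
by rewrite mulrC.
Qed.

End EnvAction.

(** A two-parameter family of modules: on the polynomials, [rep1], [rep2], [rep3]
    form a Verma module of the untwisted Lie algebra, and the two copies of it are
    exchanged according to the twist. [repA] and the multiplication by the variable
    are the lowering and the raising operators; [q] is one quarter. *)
Section PolynomialRepresentation.
Variables (K : fieldType) (eps h l q : K).
Hypothesis q4 : q *+ 4 = 1.
Implicit Types u w : {poly K}.
Local Notation V := ({poly K} * {poly K})%type.

Definition rep1 u : {poly K} := 'X * u^`() - l%:P * u.
Definition repA u : {poly K} := - (eps * q)%:P * ('X * u^`()^`() - l%:P * u^`() *+ 2).
Definition rep2 u := repA u + 'X * u.
Definition rep3 u := repA u - 'X * u.

Definition rep_op (i : 'I_4) (v : V) : V :=
  match val i with
  | 0%N => (h%:P * v.1, h%:P * v.2)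
  | 1%N => (rep1 v.2, rep1 v.1)
  | 2%N => (rep2 v.1, - rep2 v.2)
  | _ => (rep3 v.2, - rep3 v.1)
  end.

Fact rep_op_linear i : linear (rep_op i).
Proof.
move=> k [u1 u2] [w1 w2].
elim/ord4_ind: i; congr (_, _);
  rewrite /= /rep3 /rep2 /repA /rep1 ?derivD ?derivZ ?derivD ?derivZ -!mul_polyC; ring.
Qed.
HB.instance Definition _ i := GRing.isLinear.Build K V V *:%R (rep_op i) (rep_op_linear i).

Lemma quarterP : q%:P *+ 4 = 1 :> {poly K}.
Proof. by rewrite -polyCMn q4. Qed.

Lemma rep12 u : rep1 (rep2 u) - rep2 (rep1 u) = - rep3 u.
Proof. rewrite /rep3 /rep2 /repA /rep1 !derivE; ring. Qed.

Lemma rep31 u : rep3 (rep1 u) - rep1 (rep3 u) = rep2 u.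
Proof. rewrite /rep3 /rep2 /repA /rep1 !derivE; ring. Qed.

Lemma rep23 u : rep2 (rep3 u) - rep3 (rep2 u) = eps%:P * rep1 u.
Proof.
rewrite -[RHS]mul1r -quarterP /rep3 /rep2 /repA /rep1 !derivE; ring.
Qed.

Let O i : {linear V -> V} := rep_op i.

Fact rep_op0C k v : O o0 (O k v) = O k (O o0 v).
Proof.
case: v => u w; elim/ord4_ind: k; congr (_, _);
  rewrite /= /rep3 /rep2 /repA /rep1 ?derivE; ring.
Qed.

Fact rep_op12 v : O o1 (O o2 v) + O o2 (O o1 v) = O o3 v.
Proof.
case: v => u w; congr (_, _) => /=.
  by rewrite -[RHS]opprK -rep12 /rep1 derivN mulrN; ring.
by rewrite -rep12; ring.
Qed.

Fact rep_op23 v : O o2 (O o3 v) + O o3 (O o2 v) = eps *: O o1 v.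
Proof.
case: v => u w; congr (_, _) => /=; rewrite -mul_polyC -rep23.
  by rewrite /rep3 /rep2 /repA !derivN; ring.
by rewrite /rep3 /rep2 /repA !derivN; ring.
Qed.

Fact rep_op31 v : O o3 (O o1 v) + O o1 (O o3 v) = O o2 v.
Proof.
case: v => u w; congr (_, _) => /=; rewrite -rep31.
  by rewrite /rep3 /rep1 /repA !derivN; ring.
by ring.
Qed.

(** The lowest weight vector. *)
Definition vacuum : V := (1, 0).

Lemma rep_op_vacuum :
  [/\ O o0 (O o0 vacuum) = h ^+ 2 *: vacuum,
      O o1 (O o1 vacuum) = l ^+ 2 *: vacuum
    & O o2 (O o2 vacuum) + O o3 (O o3 vacuum) = (eps * l) *: vacuum].
Proof.
split.
- by congr (_, _); rewrite /= -!mul_polyC ?mulr0 // expr2 polyCM !mulr1.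
- congr (_, _); rewrite /= /rep1 -!mul_polyC ?(derivE, deriv0).
    by rewrite ?polyCX; ring.
  by ring.
- congr (_, _).
    transitivity (q%:P *+ 4 * (eps * l)%:P); last by rewrite quarterP mul1r -mul_polyC mulr1.
    by rewrite /= /rep3 /rep2 /repA ?(derivE, deriv0) ?polyCM; ring.
  by rewrite /= /rep3 /rep2 /repA -!mul_polyC ?(derivE, deriv0); ring.
Qed.

End PolynomialRepresentation.

Section Independence.
Variables (K : fieldType) (eps : K).
Hypothesis charK : [pchar K] =i pred0.
Hypothesis eps0 : eps != 0.

Lemma y_eltE : y_elt eps = eps *: Q eps o1 ^+ 2 + (Q eps o2 ^+ 2 + Q eps o3 ^+ 2).
Proof.
rewrite /y_elt /casimir sum_ord4 /bcoef /= !scale1r -ord4_0E.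
by apply/eqP; rewrite subr_eq [X in _ == X]addrC !addrA.
Qed.

(** On the lowest weight vector y acts as eps l (l + 1), and Q_0 as h. *)
Lemma eval_cy_rep (p : {poly {poly K}}) (h l : K) : eval_cy eps p = 0 ->
  (map_poly (horner_eval (eps * l * (l + 1))) p).[h ^+ 2 + eps * l * (l + 1)] = 0.
Proof.
move=> p0; have q4 : (4%:R^-1 : K) *+ 4 = 1.
  by rewrite -[_ *+ 4]mulr_natr mulVf // (proj1 (pcharf0P K) charK).
pose O (i : 'I_4) : {linear ({poly K} * {poly K})%type -> ({poly K} * {poly K})%type} :=
  rep_op eps h l 4%:R^-1 i.
pose v := vacuum K.
have [v0 v1 v23] := rep_op_vacuum eps h l q4.
have O0C := rep_op0C eps h l 4%:R^-1.
have O12 := rep_op12 eps h l 4%:R^-1.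
have O23 := rep_op23 eps h l q4.
have O31 := rep_op31 eps h l 4%:R^-1.
have yv : env_act (eps := eps) O (y_elt eps) v = (eps * l * (l + 1)) *: v.
  rewrite y_eltE !(env_actD O0C O12 O23 O31) env_actZ // !expr2.
  rewrite !(env_actM O0C O12 O23 O31) !(env_actQ O0C O12 O23 O31) v1 v23.
  by rewrite scalerA -scalerDl; congr (_ *: _); ring.
have cv : env_act (eps := eps) O (casimir eps) v = (h ^+ 2 + eps * l * (l + 1)) *: v.
  have -> : casimir eps = Q eps o0 ^+ 2 + y_elt eps by rewrite /y_elt -ord4_0E addrC subrK.
  rewrite env_actD // yv expr2 env_actM // !env_actQ // v0 -scalerDl.
  by [].
have := eval_cy_act O0C O12 O23 O31 p cv yv.
rewrite p0 env_act0 // => z.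
have := congr1 (fun u : {poly K} * {poly K} => u.1`_0) z; rewrite /=.
by rewrite coef0 coefZ coef1 eqxx mulr1 => <-.
Qed.

Lemma poly_nat_root_eq0 (p : {poly K}) (f : nat -> K) : injective f ->
  (forall m, p.[f m] = 0) -> p = 0.
Proof.
move=> fI pf; apply: (@roots_geq_poly_eq0 _ p (map f (iota 0 (size p)))).
- by apply/allP => _ /mapP[m _ ->]; apply/rootP.
- by rewrite map_inj_uniq ?iota_uniq.
- by rewrite size_map size_iota.
Qed.

Lemma natr_inj : injective (fun m : nat => m%:R : K).
Proof.
move=> m m'; wlog mm : m m' / (m <= m')%N => [H E|/eqP].
  by case/orP: (leq_total m m') => /H; [exact | move=> h; exact/esym/h].
rewrite eq_sym -subr_eq0 -natrB // (proj1 (pcharf0P K) charK).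
by rewrite subn_eq0 => m'm; apply/eqP; rewrite eqn_leq mm.
Qed.

Lemma eval_cy_inj : injective (eval_cy eps).
Proof.
suff H p : eval_cy eps p = 0 -> p = 0.
  move=> p q pq; apply/eqP; rewrite -subr_eq0; apply/eqP/H.
  by rewrite /eval_cy rmorphB hornerD hornerN [X in X - _]pq subrr.
move=> p0; apply/polyP => i; rewrite coef0.
apply: (@poly_nat_root_eq0 _ (fun l => eps * l%:R * (l%:R + 1))).
  move=> l m /eqP; rewrite -!mulrA (inj_eq (mulfI eps0)) !natr1 -!natrM => /eqP/natr_inj.
  by nia.
move=> l; set eta := eps * _ * _.
suff: map_poly (horner_eval eta) p = 0.
  by move/polyP/(_ i); rewrite coef_map coef0.
apply: (@poly_nat_root_eq0 _ (fun h => h%:R ^+ 2 + eta)).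
  move=> h m /addIr /eqP; rewrite -!natrX => /eqP/natr_inj.
  by nia.
by move=> h; exact: eval_cy_rep.
Qed.

End Independence.

(** * Deframing *)

Section Extend.
Variables (K : fieldType) (n : nat) (V : lmodType K) (F : diag n -> V).

Lemma extend_linear : linear (extend F).
Proof.
move=> k x y; rewrite /extend scaler_sumr -big_split; apply: eq_bigr => D _ /=.
by rewrite !ffunE scalerDl scalerA.
Qed.
HB.instance Definition _ :=
  GRing.isLinear.Build K (chords K n) V *:%R (extend F) extend_linear.

Lemma extend_delta D : extend F (delta K D) = F D.
Proof.
rewrite /extend (bigD1 D) //= ffunE eqxx scale1r big1 ?addr0 // => E ED.
by rewrite ffunE (negPf ED) scale0r.
Qed.

End Extend.

Section Main.
Variables (K : fieldType) (eps : K) (e : int).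
Hypotheses (e1 : e = 1 \/ e = -1) (epsE : eps = e%:~R).
Local Notation A := (A1env eps).
Local Notation R := 'M[A]_2.
Local Notation J := (twisted eps).
Local Notation c := (casimir eps).
Local Notation y := (y_elt eps).
Let JC := twistedC epsE.

HB.instance Definition _ n :=
  GRing.Linear.copy (@weight_lin K eps n) (extend (@weight K eps n)).

Lemma scalar_mx_inj : injective (@scalar_mx A 2).
Proof. by move=> u v /matrixP/(_ ord0 ord0); rewrite !mxE eqxx !mulr1n. Qed.

Lemma twisted_sqr k : J k * J k *~ metric e k = (bcoef eps k *: Q eps k ^+ 2)%:M.
Proof.
rewrite twistedM !addbb (_ : pauli false false = 1); last by rewrite /pauli !expr0 mulr1.
rewrite rmorph1 mulr1 -scalar_mxMz -mulrzA -(cocycle_diag_metric epsE) scaler_int.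
by rewrite expr2.
Qed.

Lemma casimirM : \sum_k J k * J k *~ metric e k = c%:M.
Proof. by rewrite /casimir raddf_sum; apply: eq_bigr => k _; exact: twisted_sqr. Qed.

Lemma casimir3M : casimir3 e J = y%:M.
Proof.
rewrite /y_elt raddfB /= -casimirM (bigD1 ord0) //= twisted_sqr /bcoef /= scale1r.
by rewrite addrAC subrr add0r.
Qed.

Lemma twisted0 : J ord0 * J ord0 = (Q eps ord0 ^+ 2)%:M.
Proof. by rewrite -[LHS]mulr1z (twisted_sqr ord0) /bcoef /= scale1r. Qed.

Lemma weight_perm n (D D' : diag n) (p : {perm 'I_n}) :
  D' = map p D :> seq _ -> weight eps D' = weight eps D.
Proof.
move=> DD; apply: scalar_mx_inj; rewrite -!(word_sum_weight epsE) DD.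
exact: word_sum_perm.
Qed.

Lemma weight_rot n (D D' : diag n) k :
  D' = rot k D :> seq _ -> weight eps D' = weight eps D.
Proof.
move=> DD; apply: scalar_mx_inj; rewrite -!(word_sum_weight epsE) DD.
by apply: word_sum_rot => // d; exact: diag_count.
Qed.

Lemma weight_4T n (D1 D2 D3 D4 : diag n) (a b : 'I_n) (p q r : seq 'I_n) :
    D1 = p ++ [:: a; b] ++ q ++ [:: b] ++ r :> seq _ ->
    D2 = p ++ [:: b; a] ++ q ++ [:: b] ++ r :> seq _ ->
    D3 = p ++ [:: b] ++ q ++ [:: a; b] ++ r :> seq _ ->
    D4 = p ++ [:: b] ++ q ++ [:: b; a] ++ r :> seq _ ->
  weight eps D1 - weight eps D2 + weight eps D3 - weight eps D4 = 0.
Proof.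
move=> E1 E2 E3 E4; apply: scalar_mx_inj.
rewrite !(raddfB, raddfD) raddf0 /= -!(word_sum_weight epsE) E1 E2 E3 E4.
have := diag_count D1 b; rewrite E1 !count_cat /= !eqxx => b2.
apply: word_sum_4T => //; first by apply/eqP => ab; move: b2; rewrite ab eqxx; count_lia.
by apply/count_memPn; move: b2; rewrite !count_cat; count_lia.
Qed.

Lemma weight_lin_relator n (x : chords K n) : relator x -> weight_lin eps x = 0.
Proof.
elim=> {x} [D D' p DD|D D' k DD|D1 D2 D3 D4 a b p q r E1 E2 E3 E4||k x z _ IHx _ IHz].
- by rewrite linearB /= /weight_lin !extend_delta (weight_perm DD) subrr.
- by rewrite linearB /= /weight_lin !extend_delta (weight_rot DD) subrr.
- rewrite !(linearB, linearD) /= /weight_lin !extend_delta.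
  exact: weight_4T E1 E2 E3 E4.
- exact: linear0.
- by rewrite linearP /= IHx IHz scaler0 addr0.
Qed.

Lemma weight_isolated n (D : diag n) : weight eps (add_isolated D) = c * weight eps D.
Proof.
apply: scalar_mx_inj; rewrite rmorphM /= -!(word_sum_weight epsE) -casimirM.
exact: word_sum_isolated.
Qed.

Lemma weight_lin_theta n (x : chords K n) : weight_lin eps (theta x) = c * weight_lin eps x.
Proof.
rewrite /theta {1}/extend linear_sum [in RHS]/weight_lin [in RHS]/extend mulr_sumr.
apply: eq_bigr => D _.
by rewrite linearZ /= /weight_lin extend_delta weight_isolated scalerAr.
Qed.

Definition weight_poly n (D : diag n) : {poly R} := word_poly e J D.

(** The derivatives of the weight polynomial; its values are scalar matrices, of which
    the first entry is retained. *)
Definition weight_deriv k n (D : diag n) : A :=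
  (weight_poly D)^`(k).[J ord0 * J ord0] ord0 ord0.

Lemma weight_deriv0 n (D : diag n) : weight_deriv 0 D = weight eps D.
Proof.
rewrite /weight_deriv derivn0 horner_word_poly //; last exact: diag_count.
by rewrite (word_sum_weight epsE) mxE eqxx mulr1n.
Qed.

Lemma weight_derivS k n (D : diag n.+1) :
  weight_deriv k.+1 D = \sum_a weight_deriv k (del_chord D a).
Proof.
rewrite /weight_deriv derivSn deriv_word_poly raddf_sum /= horner_sum summxE.
by [].
Qed.

(** Up to the factor c^k, the operator theta^k s^k is the k-th derivative. *)
Lemma weight_lin_theta_s k n (x : chords K n) : (k <= n)%N ->
  weight_lin eps (theta_s k x) = c ^+ k * extend (@weight_deriv k n) x.
Proof.
elim: k n x => [|k IH] n x kn.
  rewrite expr0 mul1r; case: n x kn => [|n] x _;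
  by apply: eq_bigr => D _; rewrite weight_deriv0.
case: n x kn => [//|n] x kn.
rewrite /= weight_lin_theta IH // mulrA -exprS; congr (_ * _).
rewrite /s_map {2}/extend linear_sum; apply: eq_bigr => D _.
rewrite linearZ linear_sum weight_derivS; congr (_ *: _).
by apply: eq_bigr => a _; exact: extend_delta.
Qed.

Local Notation phi_y := (horner_alg y).

Lemma casimirQ0C : GRing.comm c (Q eps ord0).
Proof.
rewrite /casimir; apply/commr_sym/commr_sum => i _.
rewrite /GRing.comm -scalerAr -scalerAl; congr (_ *: _).
by apply: commrX; rewrite -ord4_0E; exact: Q0C.
Qed.

Lemma comm_horner_alg z q : GRing.comm z y -> GRing.comm z (phi_y q).
Proof.
move=> zy; elim/poly_ind: q => [|q k IH]; first by rewrite rmorph0; exact: commr0.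
rewrite rmorphD rmorphM /= horner_algX horner_algC; apply: commrD; first exact: commrM.
by rewrite /GRing.comm -scalerAr -scalerAl mulr1 mul1r.
Qed.

Lemma casimir_yC : GRing.comm c y.
Proof. by apply: commrB; [exact: commr_refl | apply: commrX; exact: casimirQ0C]. Qed.

Lemma casimir_commr : commr_rmorph phi_y c.
Proof. by move=> q; apply: comm_horner_alg casimir_yC. Qed.

Lemma casimir_hornerC (p : {poly {poly K}}) :
  GRing.comm c (map_poly phi_y p).[Q eps ord0 ^+ 2].
Proof.
elim/poly_ind: p => [|p q IH]; first by rewrite rmorph0 horner0; exact: commr0.
rewrite rmorphD rmorphM /= map_polyX map_polyC /= hornerMXaddC; apply: commrD.
  by apply: commrM => //; apply: commrX; exact: casimirQ0C.
exact/comm_horner_alg/casimir_yC.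
Qed.

(** As Q_0^2 = c - y, a polynomial in Q_0^2 and y is a polynomial in c and y. *)
Lemma eval_cy_comp (p : {poly {poly K}}) :
  eval_cy eps (p \Po ('X - 'X%:P)) = (map_poly phi_y p).[Q eps ord0 ^+ 2].
Proof.
have morph : eval_cy eps =1 horner_morph casimir_commr by [].
rewrite morph; elim/poly_ind: p => [|p q IH].
  by rewrite comp_poly0 !rmorph0 horner0.
rewrite comp_poly_MXaddC rmorphD rmorphM rmorphB /= IH horner_morphX !horner_morphC /=.
rewrite horner_algX rmorphD rmorphM /= map_polyX map_polyC /= hornerMXaddC.
by congr (_ * _ + _); rewrite /y_elt opprB addrC subrK.
Qed.

(** The coefficients of the weight polynomial are polynomials in y. *)
Lemma weight_poly_lift n (D : diag n) : exists p : {poly {poly K}},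
  weight_poly D = map_poly (@scalar_mx A 2) (map_poly phi_y p).
Proof.
pose f : {rmorphism {poly K} -> R} := (@scalar_mx A 2) \o phi_y.
have casE : casimir3 e J = f 'X by rewrite casimir3M /= horner_algX.
have [p pE] := @word_poly_image _ e e1 J JC _ f 'X casE n D (diag_count D).
by exists p; rewrite [LHS]pE map_poly_comp.
Qed.

Lemma weight_deriv_lift n (D : diag n) (p : {poly {poly K}}) k :
    weight_poly D = map_poly (@scalar_mx A 2) (map_poly phi_y p) ->
  weight_deriv k D = (map_poly phi_y p)^`(k).[Q eps ord0 ^+ 2].
Proof.
move=> Dp; rewrite /weight_deriv Dp derivn_map twisted0 horner_map /=.
by rewrite mxE eqxx mulr1n.
Qed.

Hypothesis charK : [pchar K] =i pred0.

(** The deframing operator is a Taylor expansion, which shifts Q_0^2 = c - y by -c. *)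
Lemma weight_lin_phi n (D : diag n) (p : {poly {poly K}}) :
    weight_poly D = map_poly (@scalar_mx A 2) (map_poly phi_y p) ->
  weight_lin eps (phi (delta K D)) = phi_y p.[- 'X].
Proof.
move=> Dp; set P := map_poly phi_y p in Dp.
have sP : (size P <= n.+1)%N.
  rewrite -(size_map_inj_poly scalar_mx_inj) ?raddf0 // -Dp; exact: size_word_poly.
transitivity P.[Q eps ord0 ^+ 2 - c]; last first.
  have -> : Q eps ord0 ^+ 2 - c = phi_y (- 'X).
    by rewrite rmorphN /= horner_algX /y_elt opprB.
  by rewrite horner_map.
have cQ : GRing.comm (Q eps ord0 ^+ 2) (- c).
  by apply/commrN/commr_sym/commrX/casimirQ0C.
rewrite (nderiv_taylor_wide cQ sP) /phi linear_sum; apply: eq_bigr => k _.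
rewrite linearZ /= weight_lin_theta_s; last by rewrite -ltnS.
rewrite extend_delta (weight_deriv_lift _ Dp) nderivn_def hornerMn.
rewrite /P nderivn_map; set v := _.[_].
have cv : c ^+ k * v = v * c ^+ k.
  by apply/commr_sym/commrX/commr_sym/casimir_hornerC.
rewrite mulrnAr -scaler_nat scalerA mulfVK; last first.
  by rewrite (proj1 (pcharf0P K) charK) -lt0n fact_gt0.
rewrite cv [in RHS]exprNn scalerAr; congr (_ * _).
by rewrite -[X in X *: _]signr_odd scaler_sign -[X in _ = X * _]signr_odd mulr_sign.
Qed.

End Main.

Theorem theorem6p1 (K : fieldType) (charK : [pchar K] =i pred0)
    (eps : K) (heps : eps = 1 \/ eps = -1) (n : nat) (D : diag n) :
  (exists p : {poly {poly K}}, weight eps D = eval_cy eps p) /\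
  (forall p : {poly {poly K}}, weight eps D = eval_cy eps p ->
   forall x : chords K n, eq_A x (phi (delta K D)) ->
     weight_lin eps x = horner_alg (y_elt eps) p.[0]).
Proof.
have [e [e1 epsE]] : exists e : int, (e = 1 \/ e = -1) /\ eps = e%:~R.
  case: heps => ->; [exists 1|exists (-1)]; split; rewrite ?mulrN1z //; by [left|right].
have eps0 : eps != 0.
  by case: heps => ->; rewrite ?oppr_eq0 oner_eq0.
have [P DP] := weight_poly_lift e1 epsE D.
have wE : weight eps D = eval_cy eps (P \Po ('X - 'X%:P)).
  by rewrite eval_cy_comp -(weight_deriv0 epsE) (weight_deriv_lift epsE _ DP) derivn0.
split=> [|p wp x xD]; first by exists (P \Po ('X - 'X%:P)).
have -> : p = P \Po ('X - 'X%:P) by apply: (eval_cy_inj charK eps0); rewrite -wp.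
rewrite horner_comp !hornerE /= ?add0r -(weight_lin_phi epsE charK DP).
apply/eqP; rewrite -subr_eq0 -linearB; apply/eqP.
exact: (weight_lin_relator epsE xD).
Qed.
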